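(* Let $n$ be a positive integer and $z$ a real number with $0<|z|\le1/\alpha$. Then \[ \sqrt5\sum_{k=1}^\infty\frac{F_{2k}\zeta(2k)z^{2k}}{k(2k-1+2n)} = \frac{1}{2n-1}\ln\left(-\alpha^2\frac{\sin(\pi\beta z)}{\sin(\pi\alpha z)}\right) -(2n-2)!\sum_{j=1}^n(-1)^j\frac{(2n+1-2j)\operatorname{Cl}_{2j}(2\pi\alpha z)-2\pi\alpha z\operatorname{Cl}_{2j-1}(2\pi\alpha z)}{(2n+1-2j)!\,(2\pi\alpha z)^{2j-1}} +(2n-2)!\sum_{j=1}^n(-1)^j\frac{(2n+1-2j)\operatorname{Cl}_{2j}(2\pi\beta z)-2\pi\beta z\operatorname{Cl}_{2j-1}(2\pi\beta z)}{(2n+1-2j)!\,(2\pi\beta z)^{2j-1}}, \] \[ \sum_{k=1}^\infty\frac{L_{2k}\zeta(2k)z^{2k}}{k(2k-1+2n)} = -\frac{2}{(2n-1)^2}+\frac{1}{2n-1}\ln\left(-\frac{\pi^2z^2}{\sin(\pi\alpha z)\sin(\pi\beta z)}\right) -(2n-2)!\sum_{j=1}^n(-1)^j\frac{(2n+1-2j)\operatorname{Cl}_{2j}(2\pi\alpha z)-2\pi\alpha z\operatorname{Cl}_{2j-1}(2\pi\alpha z)}{(2n+1-2j)!\,(2\pi\alpha z)^{2j-1}} -(2n-2)!\sum_{j=1}^n(-1)^j\frac{(2n+1-2j)\operatorname{Cl}_{2j}(2\pi\beta z)-2\pi\beta z\operatorname{Cl}_{2j-1}(2\pi\beta z)}{(2n+1-2j)!\,(2\pi\beta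 z)^{2j-1}}. \]
   Context: $F_n$, $L_n$ are the Fibonacci and Lucas numbers ($F_0=0,F_1=1$, $L_0=2,L_1=1$, $w_n=w_{n-1}+w_{n-2}$); $\alpha=(1+\sqrt5)/2$, $\beta=(1-\sqrt5)/2$. $\zeta$ is the Riemann zeta function. Clausen functions: $\operatorname{Cl}_1(x)=-\ln(2\sin(x/2))$ and for $n\ge2$, $\operatorname{Cl}_n(x)=\sum_{k\ge1}\sin(kx)/k^n$ if $n$ is even, $\operatorname{Cl}_n(x)=\sum_{k\ge1}\cos(kx)/k^n$ if $n$ is odd.
   Formalization: Cl_1(x) is taken as -ln|2 sin(x/2)|, since 2 sin(x/2) is negative at one of 2παz, 2πβz; at |z|=1/α, where sin(παz)=0 and the right sides are undefined, the series converge and the identities hold as limits from 0<|w|<1/α. *)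

(* Defs.v *)
From Stdlib Require Import Reals Lra Lia.
From Coquelicot Require Import Coquelicot.
Open Scope R_scope.

Fixpoint fib (n : nat) : nat :=
  match n with
  | O => O
  | S m => match m with O => 1%nat | S p => (fib m + fib p)%nat end
  end.

Fixpoint lucas (n : nat) : nat :=
  match n with
  | O => 2%nat
  | S m => match m with O => 1%nat | S p => (lucas m + lucas p)%nat end
  end.

Definition alpha : R := (1 + sqrt 5) / 2.
Definition beta : R := (1 - sqrt 5) / 2.

(* Riemann zeta on Re s > 1 (only used at s = 2k, k >= 1): sum_{m>=1} m^(-s). *)
Definition zeta (s : R) : R := Series (fun m => Rpower (INR (S m)) (- s)).

(* Clausen functions.  Cl_1(x) = -ln|2 sin(x/2)| (= sum cos(kx)/k);
   for n >= 2: sin-series if n even, cos-series if n odd (sums over k >= 1). *)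
Definition Cl (n : nat) (x : R) : R :=
  match n with
  | O => 0
  | 1%nat => - ln (Rabs (2 * sin (x / 2)))
  | _ => if Nat.even n
         then Series (fun k => sin (INR (S k) * x) / INR (S k) ^ n)
         else Series (fun k => cos (INR (S k) * x) / INR (S k) ^ n)
  end.

Definition sum1 (n : nat) (g : nat -> R) : R := sum_n_m g 1 n.

Definition clterm (n : nat) (x : R) : R :=
  INR (Factorial.fact (2 * n - 2)) *
  sum1 n (fun j => (-1) ^ j *
     (INR (2 * n + 1 - 2 * j) * Cl (2 * j) x - x * Cl (2 * j - 1) x)
     / (INR (Factorial.fact (2 * n + 1 - 2 * j)) * x ^ (2 * j - 1))).

(* summands for k >= 1 (index shifted: the k-th term is at position k-1) *)
Definition termF (n : nat) (z : R) (k : nat) : R :=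
  sqrt 5 * INR (fib (2 * S k)) * zeta (INR (2 * S k)) * z ^ (2 * S k)
  / (INR (S k) * INR (2 * S k - 1 + 2 * n)).

Definition termL (n : nat) (z : R) (k : nat) : R :=
  INR (lucas (2 * S k)) * zeta (INR (2 * S k)) * z ^ (2 * S k)
  / (INR (S k) * INR (2 * S k - 1 + 2 * n)).

Definition rhsF (n : nat) (z : R) : R :=
  / INR (2 * n - 1) * ln (- alpha ^ 2 * sin (PI * beta * z) / sin (PI * alpha * z))
  - clterm n (2 * PI * alpha * z) + clterm n (2 * PI * beta * z).

Definition rhsL (n : nat) (z : R) : R :=
  - 2 / INR (2 * n - 1) ^ 2
  + / INR (2 * n - 1) * ln (- (PI ^ 2 * z ^ 2) / (sin (PI * alpha * z) * sin (PI * beta * z)))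
  - clterm n (2 * PI * alpha * z) - clterm n (2 * PI * beta * z).

Definition dom (w : R) : Prop := 0 < Rabs w < / alpha.

(* Main.v *)
Require Import Defs.
From Stdlib Require Import Reals Lra Lia Factorial.
From Coquelicot Require Import Coquelicot.
Open Scope R_scope.

(** By Binet's formulas both series are G(alpha z) -+ G(beta z), where
    G(x) = sum_k zeta(2k) x^(2k) / (k (2k-1+2n)).  On (0,1) the derivative of
    x^(2n-1) G(x) is x^(2n-2) ln(pi x / sin(pi x)), by the sine product.  The
    function x^(2n-1) times the claimed closed form of G has the same derivative:
    since Cl_{2j}' = Cl_{2j-1} and Cl_{2j+1}' = -Cl_{2j}, the Clausen sum
    telescopes and only Cl_1' = -cot/2 survives.  Both tend to 0 at 0+, hence they
    agree.  The case |z| = 1/alpha follows by dominated convergence. *)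

(* Coquelicot's operations leave equations over a structure's carrier, which [ring] rejects. *)
Ltac eq_R := match goal with |- @eq _ ?u ?v => change (@eq R u v) end.

(** * Dominated convergence *)

Lemma filterlim_sum_n {T : Type} (F : (T -> Prop) -> Prop) {FF : Filter F}
  (f : nat -> T -> R) (l : nat -> R) (N : nat) :
  (forall k, filterlim (f k) F (locally (l k))) ->
  filterlim (fun x => sum_n (fun k => f k x) N) F (locally (sum_n l N)).
Proof.
  intros Hf; induction N as [|N IH].
  - rewrite sum_O. apply filterlim_ext with (f 0%nat); [|apply Hf].
    intros x; now rewrite sum_O.
  - rewrite sum_Sn.
    apply filterlim_ext with (fun x => plus (sum_n (fun k => f k x) N) (f (S N) x)).
    { intros x; now rewrite sum_Sn. }
    exact (filterlim_comp_2 _ _ _ IH (Hf (S N)) (filterlim_plus (V := R_NormedModule) _ _)).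
Qed.

Lemma filterlim_R {T : Type} (F : (T -> Prop) -> Prop) {FF : Filter F} (f : T -> R) (l : R) :
  filterlim f F (locally l) <-> (forall eps, 0 < eps -> F (fun x => Rabs (f x - l) < eps)).
Proof.
  split; intros H.
  - intros eps Heps. exact (proj1 (filterlim_locally f l) H (mkposreal _ Heps)).
  - apply (filterlim_locally f l). intros eps. exact (H eps (cond_pos eps)).
Qed.

Lemma ex_series_dominated (a M : nat -> R) :
  ex_series M -> (forall k, Rabs (a k) <= M k) -> ex_series a.
Proof.
  intros HM Ha. apply (ex_series_le (K := R_AbsRing) (V := R_CompleteNormedModule) a M); auto.
Qed.

Lemma Series_dominated (a M : nat -> R) :
  ex_series M -> (forall k, Rabs (a k) <= M k) -> Rabs (Series a) <= Series M.
Proof.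
  intros HM Ha.
  eapply Rle_trans; [apply Series_Rabs|apply Series_le; auto using Rabs_pos].
  apply ex_series_dominated with M; auto.
  intros k; rewrite Rabs_Rabsolu; auto.
Qed.

Lemma tail_dominated (a M : nat -> R) (N : nat) :
  ex_series M -> (forall k, Rabs (a k) <= M k) ->
  Rabs (Series a - sum_n a N) <= Series M - sum_n M N.
Proof.
  intros HM Ha.
  assert (Ea := ex_series_dominated _ _ HM Ha).
  rewrite (Series_incr_n a (S N)); [|lia|auto].
  rewrite (Series_incr_n M (S N)); [|lia|auto].
  simpl pred. rewrite !sum_n_Reals.
  replace (_ + _ - _) with (Series (fun k => a (S N + k)%nat)) by ring.
  replace (_ + _ - _) with (Series (fun k => M (S N + k)%nat)) by ring.
  apply Series_dominated; [|intros; apply Ha].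
  apply (ex_series_incr_n M (S N)); auto.
Qed.

Lemma tannery {T : Type} (F : (T -> Prop) -> Prop) {FF : Filter F}
  (f : nat -> T -> R) (l M : nat -> R) :
  ex_series M ->
  (forall k, filterlim (f k) F (locally (l k))) ->
  F (fun x => forall k, Rabs (f k x) <= M k) ->
  (forall k, Rabs (l k) <= M k) ->
  filterlim (fun x => Series (fun k => f k x)) F (locally (Series l)).
Proof.
  intros HM Hf HF Hl. apply filterlim_R; [exact FF|]; intros eps Heps.
  assert (He : 0 < eps / 3) by lra.
  assert (HN : exists N, Rabs (sum_n M N - Series M) < eps / 3).
  { assert (H : is_lim_seq (sum_n M) (Series M)) by exact (Series_correct _ HM).
    apply is_lim_seq_spec in H. destruct (H (mkposreal _ He)) as [N HN].
    exists N. apply HN; lia. }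
  destruct HN as [N HN].
  assert (Hs := filterlim_sum_n F f l N Hf).
  assert (Hs' := proj1 (filterlim_R _ _ _) Hs _ He). clear Hs.
  generalize (filter_and _ _ Hs' HF); apply filter_imp; intros x [H1 H2].
  assert (T1 := tail_dominated _ _ N HM H2).
  assert (T2 := tail_dominated _ _ N HM Hl).
  revert T1 T2 H1 HN. unfold Rabs; repeat destruct Rcase_abs; lra.
Qed.

Lemma is_derive_diff_quotient (f : R -> R) (x l : R) :
  filterlim (fun h => (f (x + h) - f x) / h) (locally' 0) (locally l) -> is_derive f x l.
Proof.
  intros H. apply is_derive_Reals. intros eps Heps.
  destruct (proj1 (filterlim_R _ _ _) H _ Heps) as [d Hd]. exists d. intros h Hh0 Hh.
  apply Hd; auto. change (Rabs (h - 0) < d). now rewrite Rminus_0_r.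
Qed.

Lemma filterlim_diff_quotient (f : R -> R) (x l : R) :
  is_derive f x l -> filterlim (fun h => (f (x + h) - f x) / h) (locally' 0) (locally l).
Proof.
  intros H. apply is_derive_Reals in H. apply filterlim_R; [apply locally'_filter|]. intros eps Heps.
  destruct (H eps Heps) as [d Hd]. exists d. intros h Hh Hh0.
  apply Hd; auto. change (Rabs (h - 0) < d) in Hh. now rewrite Rminus_0_r in Hh.
Qed.

Lemma is_derive_continuity_pt (f : R -> R) (x l : R) :
  is_derive f x l -> continuity_pt f x.
Proof.
  intros H. apply derivable_continuous_pt. exists l. now apply is_derive_Reals.
Qed.

Lemma is_derive_Series (f f' : nat -> R -> R) (M' : nat -> R) (x : R) :
  (forall y, ex_series (fun k => f k y)) -> ex_series M' ->
  (forall k y, is_derive (f k) y (f' k y)) ->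
  (forall k y, Rabs (f' k y) <= M' k) ->
  is_derive (fun y => Series (fun k => f k y)) x (Series (fun k => f' k x)).
Proof.
  intros Hf HM' Hd Hb. apply is_derive_diff_quotient.
  apply filterlim_ext with (fun h => Series (fun k => (f k (x + h) - f k x) / h)).
  { intros h. unfold Rdiv. rewrite Series_scal_r, Series_minus; auto. }
  apply (tannery (locally' 0) (FF := locally'_filter 0) _ _ M'); auto.
  - intros k. apply filterlim_diff_quotient; auto.
  - exists (mkposreal 1 Rlt_0_1). intros h _ Hh0 k.
    destruct (MVT_gen (f k) x (x + h) (f' k)) as (c & _ & Hc).
    + intros y _; apply Hd.
    + intros y _. apply is_derive_continuity_pt with (f' k y); apply Hd.
    + rewrite Hc. replace (_ * _ / h) with (f' k c) by (field; auto). auto.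
Qed.

Lemma is_series_sum_n (a : nat -> R) (l : R) :
  is_series a l <-> is_lim_seq (sum_n a) l.
Proof. split; intros H; exact H. Qed.

Lemma is_derive_0_const (f : R -> R) (a b : R) :
  a <= b -> (forall x, a <= x <= b -> is_derive f x 0) -> f a = f b.
Proof.
  intros Hab Hd.
  destruct (MVT_gen f a b (fun _ => 0)) as (c & _ & Hc).
  - rewrite Rmin_left, Rmax_right by lra. intros y Hy; apply Hd; lra.
  - rewrite Rmin_left, Rmax_right by lra. intros y Hy.
    apply is_derive_continuity_pt with 0; apply Hd; lra.
  - lra.
Qed.

Lemma CV_radius_ge_1 (a : nat -> R) (M : R) :
  (forall k, Rabs (a k) <= M) -> Rbar_le 1 (CV_radius a).
Proof.
  intros H. apply (CV_radius_bounded a). exists M.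
  intros k. now rewrite pow1, Rmult_1_r.
Qed.

Lemma CV_radius_gt (a : nat -> R) (M r : R) :
  (forall k, Rabs (a k) <= M) -> Rabs r < 1 -> Rbar_lt (Rabs r) (CV_radius a).
Proof.
  intros H Hr. apply Rbar_lt_le_trans with 1; [exact Hr|]. now apply CV_radius_ge_1 with M.
Qed.

Lemma log_arg_pos (x r : R) : Rabs r < 1 -> 0 < 1 - 2 * r * cos x + r ^ 2.
Proof.
  intros Hr. apply Rabs_def2 in Hr. destruct (COS_bound x). destruct (Rle_dec 0 r).
  - assert (0 < (1 - r) ^ 2) by (apply pow_lt; lra). nra.
  - assert (0 < (1 + r) ^ 2) by (apply pow_lt; lra). nra.
Qed.

(** * The series of r^k cos(kx)/k *)

Lemma is_series_geom_cos (x r : R) : Rabs r < 1 ->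
  is_series (fun k => cos (INR (S k) * x) * r ^ k)
            ((cos x - r) / (1 - 2 * r * cos x + r ^ 2)).
Proof.
  intros Hr. assert (Hp := log_arg_pos x r Hr).
  apply is_series_sum_n.
  apply is_lim_seq_ext with (fun N => ((cos x - r) - r ^ S N * cos (INR (S (S N)) * x)
     + r ^ S (S N) * cos (INR (S N) * x)) / (1 - 2 * r * cos x + r ^ 2)).
  - intros N. induction N as [|N IH].
    + rewrite sum_O. simpl (INR 2). simpl (INR 1). rewrite !Rmult_1_l. simpl pow.
      replace ((1 + 1) * x) with (2 * x) by ring. rewrite cos_2a_cos. field. simpl in Hp; lra.
    + rewrite sum_Sn, <- IH. change (@plus _) with Rplus.
      assert (E : cos (INR (S (S (S N))) * x)
                  = 2 * cos x * cos (INR (S (S N)) * x) - cos (INR (S N) * x)).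
      { rewrite (S_INR (S (S N))).
        replace (INR (S N) * x) with (INR (S (S N)) * x - x) by (rewrite (S_INR (S N)); ring).
        rewrite Rmult_plus_distr_r, Rmult_1_l, cos_plus, cos_minus. ring. }
      rewrite E. simpl pow in *. field. lra.
  - assert (H0 : forall (c : nat -> R) p, (forall k, Rabs (c k) <= 1) ->
       is_lim_seq (fun N => r ^ (p + N) * c N) 0).
    { intros c p Hc. apply is_lim_seq_abs_0.
      apply is_lim_seq_le_le with (fun _ => 0) (fun N => Rabs r ^ (N + p)).
      - intros N. split; [apply Rabs_pos|]. rewrite Rabs_mult, <- RPow_abs, Nat.add_comm.
        rewrite <- (Rmult_1_r (Rabs r ^ _)) at 2. apply Rmult_le_compat_l; auto.
        apply pow_le, Rabs_pos.
      - apply is_lim_seq_const.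
      - apply (is_lim_seq_incr_n (fun N => Rabs r ^ N)), is_lim_seq_geom.
        now rewrite Rabs_Rabsolu. }
    assert (Hc : forall y, Rabs (cos y) <= 1) by (intros y; apply Rabs_le, COS_bound).
    replace (Finite _) with
      (Finite (((cos x - r) - 0 + 0) / (1 - 2 * r * cos x + r ^ 2))) by (do 2 f_equal; ring).
    apply is_lim_seq_scal_r with (a := / _) (lu := Finite ((cos x - r) - 0 + 0)).
    apply is_lim_seq_plus'; [apply is_lim_seq_minus'|].
    + apply is_lim_seq_const.
    + apply (H0 (fun N => cos (INR (S (S N)) * x)) 1%nat). auto.
    + apply (H0 (fun N => cos (INR (S N) * x)) 2%nat). auto.
Qed.

Definition log_coef (x : R) (k : nat) : R :=
  match k with O => 0 | S _ => cos (INR k * x) / INR k end.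

Lemma INR_S_ge_1 (k : nat) : 1 <= INR (S k).
Proof. rewrite S_INR. generalize (pos_INR k); lra. Qed.

Lemma Rabs_div_le (a b : R) : 1 <= b -> Rabs (a / b) <= Rabs a.
Proof.
  intros Hb. unfold Rdiv. rewrite Rabs_mult, Rabs_inv, (Rabs_pos_eq b) by lra.
  rewrite <- (Rmult_1_r (Rabs a)) at 2. apply Rmult_le_compat_l; [apply Rabs_pos|].
  rewrite <- Rinv_1. apply Rinv_le_contravar; lra.
Qed.

Lemma log_coef_bound (x : R) (k : nat) : Rabs (log_coef x k) <= 1.
Proof.
  destruct k as [|k]; unfold log_coef; [rewrite Rabs_R0; lra|].
  eapply Rle_trans; [apply Rabs_div_le, INR_S_ge_1|]. apply Rabs_le, COS_bound.
Qed.

Lemma PSeries_log_coef (x r : R) : Rabs r < 1 ->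
  PSeries (log_coef x) r = - / 2 * ln (1 - 2 * r * cos x + r ^ 2).
Proof.
  intros Hr.
  set (f := fun t => PSeries (log_coef x) t + / 2 * ln (1 - 2 * t * cos x + t ^ 2)).
  assert (Hd : forall t, Rabs t < 1 -> is_derive f t 0).
  { intros t Ht. assert (Hp := log_arg_pos x t Ht). unfold f.
    assert (H1 := is_derive_PSeries (log_coef x) t
              (CV_radius_gt _ 1 t (log_coef_bound x) Ht)).
    assert (H2 : PSeries (PS_derive (log_coef x)) t
                 = (cos x - t) / (1 - 2 * t * cos x + t ^ 2)).
    { rewrite <- (is_series_unique _ _ (is_series_geom_cos x t Ht)).
      apply Series_ext. intros k. unfold PS_derive, log_coef. field.
      generalize (INR_S_ge_1 k); lra. }
    rewrite H2 in H1.
    assert (H3 : is_derive (fun t => / 2 * ln (1 - 2 * t * cos x + t ^ 2)) t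
                   (- ((cos x - t) / (1 - 2 * t * cos x + t ^ 2)))).
    { auto_derive; [simpl in *; lra|]. field. simpl in *; lra. }
    replace 0 with (plus ((cos x - t) / (1 - 2 * t * cos x + t ^ 2))
       (- ((cos x - t) / (1 - 2 * t * cos x + t ^ 2)))) by (unfold plus; simpl; ring).
    now apply (is_derive_plus (PSeries (log_coef x))). }
  assert (H0 : f 0 = 0).
  { unfold f. rewrite PSeries_0. unfold log_coef.
    replace (1 - 2 * 0 * cos x + 0 ^ 2) with 1 by ring. rewrite ln_1; ring. }
  assert (Hfr : f r = 0).
  { rewrite <- H0. apply Rabs_def2 in Hr. destruct (Rle_dec 0 r).
    - symmetry; apply is_derive_0_const; auto. intros t Ht; apply Hd, Rabs_def1; lra.
    - apply is_derive_0_const; [lra|]. intros t Ht; apply Hd, Rabs_def1; lra. }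
  unfold f in Hfr. lra.
Qed.

Lemma is_series_log_cos (x r : R) : Rabs r < 1 ->
  is_series (fun k => r ^ S k * cos (INR (S k) * x) / INR (S k))
            (- / 2 * ln (1 - 2 * r * cos x + r ^ 2)).
Proof.
  intros Hr.
  assert (E : ex_pseries (log_coef x) r)
    by (apply CV_radius_inside, CV_radius_gt with 1; auto using log_coef_bound).
  assert (H := PSeries_correct _ _ E). rewrite PSeries_log_coef in H by auto.
  apply is_pseries_R in H.
  apply is_series_ext with (fun k => log_coef x (S k) * r ^ S k).
  { intros k. unfold log_coef. change (cos (INR (S k) * x) / INR (S k) * r ^ S k = r ^ S k * cos (INR (S k) * x) / INR (S k)). field. generalize (INR_S_ge_1 k); lra. }
  apply (is_series_incr_1 (fun k => log_coef x k * r ^ k)).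
  replace (plus _ _) with (- / 2 * ln (1 - 2 * r * cos x + r ^ 2)); [exact H|].
  unfold plus, log_coef; simpl. ring.
Qed.

Lemma is_series_ln (v : R) : Rabs v < 1 ->
  is_series (fun k => v ^ S k / INR (S k)) (- ln (1 - v)).
Proof.
  intros Hv. assert (H := is_series_log_cos 0 v Hv).
  replace (- ln (1 - v)) with (- / 2 * ln (1 - 2 * v * cos 0 + v ^ 2)).
  - revert H; apply is_series_ext. intros k. now rewrite Rmult_0_r, cos_0, Rmult_1_r.
  - rewrite cos_0. replace (1 - 2 * v * 1 + v ^ 2) with ((1 - v) * (1 - v)) by ring.
    apply Rabs_def2 in Hv. rewrite ln_mult by lra. lra.
Qed.

(** * The sine product *)

Lemma ex_RInt_ex_derive (f : R -> R) (a b : R) :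
  (forall t, ex_derive f t) -> ex_RInt f a b.
Proof.
  intros H. apply (ex_RInt_continuous (V := R_CompleteNormedModule)).
  intros t _. now apply (ex_derive_continuous (V := R_NormedModule)).
Qed.

Definition cos_int (x : R) (n : nat) : R :=
  RInt (fun t => cos (2 * x * t) * cos t ^ n) 0 (PI / 2).

Lemma ex_RInt_cos_int (x : R) (n : nat) :
  ex_RInt (fun t => cos (2 * x * t) * cos t ^ n) 0 (PI / 2).
Proof. apply ex_RInt_ex_derive. intros t. auto_derive; auto. Qed.

Lemma cos_int_rec (x : R) (n : nat) :
  (INR (n + 2) ^ 2 - 4 * x ^ 2) * cos_int x (n + 2) = INR (n + 2) * INR (n + 1) * cos_int x n.
Proof.
  set (K := fun t => INR (n + 2) * (cos t ^ (n + 1) * sin t * cos (2 * x * t))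
                     - 2 * x * (cos t ^ (n + 2) * sin (2 * x * t))).
  set (k := fun t => (INR (n + 2) ^ 2 - 4 * x ^ 2) * (cos (2 * x * t) * cos t ^ (n + 2))
                     - INR (n + 2) * INR (n + 1) * (cos (2 * x * t) * cos t ^ n)).
  assert (H1 : is_RInt k 0 (PI / 2) (minus (K (PI / 2)) (K 0))).
  { apply (is_RInt_derive (V := R_CompleteNormedModule)).
    - intros t _. unfold K, k. auto_derive; auto.
      replace (n + 2)%nat with (S (S n)) by lia. replace (n + 1)%nat with (S n) by lia.
      simpl pred. rewrite !S_INR. simpl pow.
      assert (E : sin t * sin t = 1 - cos t * cos t)
        by (generalize (sin2_cos2 t); unfold Rsqr; lra).
      match goal with |- ?L = ?R =>
      replace L with (L + (INR n + 2) * (INR n + 1) * cos t ^ n * cos (2 * x * t) * (sin t * sin t - (1 - cos t * cos t))) by (rewrite E; ring) end.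
      ring.
    - intros t _. apply (ex_derive_continuous (V := R_NormedModule)).
      unfold k. auto_derive; auto. }
  assert (H2 : RInt k 0 (PI / 2) = (INR (n + 2) ^ 2 - 4 * x ^ 2) * cos_int x (n + 2)
     - INR (n + 2) * INR (n + 1) * cos_int x n).
  { apply (is_RInt_unique (V := R_CompleteNormedModule)).
    apply (is_RInt_minus (V := R_NormedModule));
    apply (is_RInt_scal (V := R_NormedModule)); apply (RInt_correct (V := R_CompleteNormedModule));
    apply ex_RInt_cos_int. }
  apply (is_RInt_unique (V := R_CompleteNormedModule)) in H1. rewrite H2 in H1.
  assert (H3 : minus (K (PI / 2)) (K 0) = 0).
  { unfold K. rewrite cos_PI2, sin_0, !Rmult_0_r, sin_0, !Nat.add_succ_r. simpl.
    unfold minus, plus, opp; simpl. ring. }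
  rewrite H3 in H1. lra.
Qed.

Lemma cos_int_0 (x : R) : x <> 0 -> cos_int x 0 = sin (PI * x) / (2 * x).
Proof.
  intros Hx. apply (is_RInt_unique (V := R_CompleteNormedModule)).
  replace (sin (PI * x) / (2 * x)) with
    (minus (sin (2 * x * (PI / 2)) / (2 * x)) (sin (2 * x * 0) / (2 * x))).
  - apply (is_RInt_derive (V := R_CompleteNormedModule) (fun t => sin (2 * x * t) / (2 * x))).
    + intros t _. auto_derive; auto. simpl. field; auto.
    + intros t _. apply (ex_derive_continuous (V := R_NormedModule)). auto_derive; auto.
  - rewrite Rmult_0_r, sin_0. replace (2 * x * (PI / 2)) with (PI * x) by field.
    unfold minus, plus, opp; simpl. field; auto.
Qed.

Lemma cos_int_0_0 : cos_int 0 0 = PI / 2.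
Proof.
  unfold cos_int. rewrite (RInt_ext _ (fun _ => 1)).
  - rewrite RInt_const. unfold scal; simpl; unfold mult; simpl. ring.
  - intros t _. simpl. rewrite Rmult_1_r.
    replace (2 * 0 * t) with 0 by ring. apply cos_0.
Qed.

Lemma cos_int_pos (n : nat) : 0 < cos_int 0 n.
Proof.
  generalize PI_RGT_0; intros HPI.
  apply RInt_gt_0; [lra| |].
  - intros t Ht. replace (2 * 0 * t) with 0 by ring. rewrite cos_0, Rmult_1_l.
    apply pow_lt, cos_gt_0; lra.
  - intros t _. apply (ex_derive_continuous (V := R_NormedModule)). auto_derive; auto.
Qed.

Lemma Rabs_sin_le (u : R) : Rabs (sin u) <= Rabs u.
Proof.
  destruct (MVT_gen sin 0 u cos) as (c & _ & Hc).
  - intros y _. apply is_derive_Reals, derivable_pt_lim_sin.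
  - intros y _. apply continuity_sin.
  - rewrite sin_0, !Rminus_0_r in Hc. rewrite Hc, Rabs_mult.
    rewrite <- (Rmult_1_l (Rabs u)) at 2. apply Rmult_le_compat_r; [apply Rabs_pos|].
    apply Rabs_le, COS_bound.
Qed.

Lemma one_minus_cos_le (u : R) : 1 - cos (2 * u) <= 2 * u ^ 2.
Proof.
  rewrite cos_2a_sin. generalize (Rabs_sin_le u); intros H.
  apply Rsqr_le_abs_1 in H. unfold Rsqr in H. lra.
Qed.

Lemma mult_cos_le_sin (t : R) : 0 <= t <= PI / 2 -> 0 <= t * cos t <= sin t.
Proof.
  intros Ht. split; [apply Rmult_le_pos; [lra|apply cos_ge_0; lra]|].
  destruct (MVT_gen (fun s => sin s - s * cos s) 0 t (fun s => s * sin s)) as (c & Hc1 & Hc).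
  - intros y _. auto_derive; auto. ring.
  - intros y _. apply is_derive_continuity_pt with (y * sin y). auto_derive; auto. ring.
  - rewrite Rmin_left, Rmax_right in Hc1 by lra.
    rewrite sin_0 in Hc. ring_simplify in Hc.
    assert (0 <= c * sin c * t).
    { repeat apply Rmult_le_pos; try lra. apply sin_ge_0; lra. }
    lra.
Qed.

Lemma cos_int_dist (x : R) (n : nat) :
  Rabs (cos_int x (n + 2) - cos_int 0 (n + 2)) <= 2 * x ^ 2 / INR (n + 1) * cos_int 0 (n + 2).
Proof.
  generalize PI_RGT_0; intros HPI.
  assert (Hn : 0 < INR (n + 1)) by (apply lt_0_INR; lia).
  assert (Hr := cos_int_rec 0 n).
  assert (E0 : cos_int 0 n = INR (n + 2) / INR (n + 1) * cos_int 0 (n + 2)).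
  { apply Rmult_eq_reg_l with (INR (n + 2) * INR (n + 1)).
    - rewrite <- Hr. field. lra.
    - rewrite !plus_INR in *. generalize (pos_INR n); simpl in *; nra. }
  set (d := fun t => 2 * x ^ 2 * (cos (2 * 0 * t) * cos t ^ n - cos (2 * 0 * t) * cos t ^ (n + 2))).
  assert (Id : is_RInt d 0 (PI / 2) (2 * x ^ 2 * (cos_int 0 n - cos_int 0 (n + 2)))).
  { apply (is_RInt_scal (V := R_NormedModule)), (is_RInt_minus (V := R_NormedModule));
    apply (RInt_correct (V := R_CompleteNormedModule)); apply ex_RInt_cos_int. }
  assert (E1 : 2 * x ^ 2 / INR (n + 1) * cos_int 0 (n + 2)
               = 2 * x ^ 2 * (cos_int 0 n - cos_int 0 (n + 2))).
  { assert (En : INR (n + 2) = INR (n + 1) + 1) by (rewrite <- S_INR; f_equal; lia).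
    rewrite E0, En. field. lra. }
  rewrite E1, <- (is_RInt_unique _ _ _ _ Id).
  set (g := fun t => cos (2 * x * t) * cos t ^ (n + 2) - cos (2 * 0 * t) * cos t ^ (n + 2)).
  replace (cos_int x (n + 2) - cos_int 0 (n + 2)) with (RInt g 0 (PI / 2)).
  2:{ apply (is_RInt_unique (V := R_CompleteNormedModule)). apply (is_RInt_minus (V := R_NormedModule));
      apply (RInt_correct (V := R_CompleteNormedModule)); apply ex_RInt_cos_int. }
  eapply Rle_trans; [apply abs_RInt_le; [lra|]|].
  { apply ex_RInt_ex_derive. intros t. unfold g. auto_derive; auto. }
  apply RInt_le; [lra| | |].
  - apply (ex_RInt_continuous (V := R_CompleteNormedModule)).
    intros t _. apply (continuous_comp g Rabs); [|apply continuous_Rabs].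
    apply (ex_derive_continuous (V := R_NormedModule)). unfold g. auto_derive; auto.
  - eexists; exact Id.
  - intros t Ht. unfold g, d. rewrite Rmult_0_r, Rmult_0_l, cos_0.
    replace (n + 2)%nat with (S (S n)) by lia. simpl pow.
    assert (Hc : 0 < cos t) by (apply cos_gt_0; lra).
    assert (Hp : 0 <= cos t ^ n) by (apply pow_le; lra).
    assert (Hm := mult_cos_le_sin t ltac:(lra)).
    assert (Hs := one_minus_cos_le (x * t)). rewrite <- Rmult_assoc in Hs.
    assert (Hb := COS_bound (2 * x * t)).
    assert (E : sin t * sin t = 1 - cos t * cos t)
        by (generalize (sin2_cos2 t); unfold Rsqr; lra).
    assert (Hq : (t * cos t) * (t * cos t) <= sin t * sin t) by (apply Rmult_le_compat; lra).
    rewrite E in Hq.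
    replace (_ - _) with (- ((1 - cos (2 * x * t)) * (cos t * (cos t * cos t ^ n)))) by ring.
    rewrite Rabs_Ropp, Rabs_pos_eq.
    2:{ apply Rmult_le_pos; [lra|]. repeat apply Rmult_le_pos; lra. }
    apply Rle_trans with (2 * (x * t) ^ 2 * (cos t * (cos t * cos t ^ n))).
    { apply Rmult_le_compat_r; [repeat apply Rmult_le_pos; lra|lra]. }
    replace (2 * (x * t) ^ 2 * _) with (2 * x ^ 2 * cos t ^ n * ((t * cos t) * (t * cos t))) by ring.
    eapply Rle_trans; [|apply Req_le; transitivity (2 * x ^ 2 * cos t ^ n * (1 - cos t * cos t)); [reflexivity|ring]].
    apply Rmult_le_compat_l; auto.
    apply Rmult_le_pos; auto. generalize (pow2_ge_0 x); lra.
Qed.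

Definition cos_ratio (x : R) (m : nat) : R := cos_int x (2 * m) / cos_int 0 (2 * m).

Lemma cos_ratio_rec (x : R) (m : nat) :
  (1 - x ^ 2 / INR (S m) ^ 2) * cos_ratio x (S m) = cos_ratio x m.
Proof.
  unfold cos_ratio. replace (2 * S m)%nat with (2 * m + 2)%nat by lia.
  assert (H1 := cos_int_rec x (2 * m)). assert (H0 := cos_int_rec 0 (2 * m)).
  assert (P1 := cos_int_pos (2 * m)). assert (P2 := cos_int_pos (2 * m + 2)).
  assert (Hm : 0 < INR (S m)) by (apply lt_0_INR; lia).
  assert (E : INR (2 * m + 2) = 2 * INR (S m)).
  { replace (2 * m + 2)%nat with (2 * S m)%nat by lia. now rewrite mult_INR. }
  rewrite E in *.
  assert (Q : 0 < INR (2 * m + 1)) by (apply lt_0_INR; lia).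
  set (q := INR (2 * m + 1)) in *. set (s := INR (S m)) in *.
  apply Rmult_eq_reg_l with (2 * s * q * cos_int 0 (2 * m) * cos_int 0 (2 * m + 2)).
  2:{ apply Rgt_not_eq. repeat apply Rmult_lt_0_compat; lra. }
  transitivity (((2 * s) ^ 2 - 4 * x ^ 2) * cos_int x (2 * m + 2) *
                (q * cos_int 0 (2 * m) / (2 * s))); [field; lra|].
  transitivity (2 * s * q * cos_int x (2 * m) * cos_int 0 (2 * m + 2)); [|field; lra].
  rewrite H1.
  assert (E2 : q * cos_int 0 (2 * m) = 2 * s * cos_int 0 (2 * m + 2)).
  { apply Rmult_eq_reg_l with (2 * s); [|lra].
    transitivity (2 * s * q * cos_int 0 (2 * m)); [ring|]. rewrite <- H0. ring. }
  rewrite E2. field. lra.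
Qed.

Lemma cos_ratio_lim (x : R) : is_lim_seq (cos_ratio x) 1.
Proof.
  apply is_lim_seq_incr_1.
  apply is_lim_seq_ext with (fun m => (cos_ratio x (S m) - 1) + 1); [intros; ring|].
  replace (Finite 1) with (Finite (0 + 1)) by (f_equal; ring).
  apply is_lim_seq_plus'; [|apply is_lim_seq_const].
  apply is_lim_seq_abs_0.
  apply is_lim_seq_le_le with (fun _ => 0) (fun m => 2 * x ^ 2 * / INR (S m)).
  - intros m. split; [apply Rabs_pos|].
    unfold cos_ratio. replace (2 * S m)%nat with (2 * m + 2)%nat by lia.
    assert (H := cos_int_dist x (2 * m)). assert (P2 := cos_int_pos (2 * m + 2)).
    replace (_ / _ - 1) with ((cos_int x (2 * m + 2) - cos_int 0 (2 * m + 2)) / cos_int 0 (2 * m + 2))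
      by (field; lra).
    unfold Rdiv. rewrite Rabs_mult, Rabs_inv, (Rabs_pos_eq (cos_int 0 _)) by lra.
    apply Rmult_le_reg_r with (cos_int 0 (2 * m + 2)); auto.
    rewrite Rmult_assoc, Rinv_l, Rmult_1_r by lra.
    eapply Rle_trans; [exact H|]. apply Rmult_le_compat_r; [lra|].
    apply Rmult_le_compat_l; [generalize (pow2_ge_0 x); lra|].
    apply Rinv_le_contravar; [apply lt_0_INR; lia|apply le_INR; lia].
  - apply is_lim_seq_const.
  - replace (Finite 0) with (Rbar_mult (2 * x ^ 2) 0) by (simpl; f_equal; ring).
    apply is_lim_seq_scal_l.
    apply (is_lim_seq_incr_1 (fun m => / INR m)).
    replace (Finite 0) with (Rbar_inv p_infty) by reflexivity.
    apply is_lim_seq_inv; [apply is_lim_seq_INR|discriminate].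
Qed.

Lemma is_series_log_sin (x : R) : 0 < x < 1 ->
  is_series (fun k => - ln (1 - x ^ 2 / INR (S k) ^ 2)) (ln (PI * x / sin (PI * x))).
Proof.
  intros Hx. generalize PI_RGT_0; intros HPI.
  assert (Hs : 0 < sin (PI * x)) by (apply sin_gt_0; nra).
  assert (Hf : forall k, 0 < 1 - x ^ 2 / INR (S k) ^ 2).
  { intros k. generalize (INR_S_ge_1 k); intros Hk.
    apply Rlt_0_minus. apply Rmult_lt_reg_r with (INR (S k) ^ 2); [apply pow_lt; lra|].
    field_simplify; nra. }
  assert (H0 : cos_ratio x 0 = / (PI * x / sin (PI * x))).
  { unfold cos_ratio. simpl Nat.mul. rewrite cos_int_0, cos_int_0_0 by lra. field. lra. }
  assert (Hq : 0 < PI * x / sin (PI * x)) by (apply Rdiv_lt_0_compat; nra).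
  assert (HJ : forall m, 0 < cos_ratio x m).
  { induction m as [|m IH]; [rewrite H0; now apply Rinv_0_lt_compat|].
    rewrite <- cos_ratio_rec in IH. generalize (Hf m); nra. }
  apply is_series_sum_n.
  apply is_lim_seq_ext with (fun m => ln (PI * x / sin (PI * x)) + ln (cos_ratio x (S m))).
  - induction n as [|n IH].
    + rewrite sum_O. rewrite <- ln_mult by auto.
      generalize (Hf 0%nat) (HJ 1%nat) (cos_ratio_rec x 0). rewrite H0. intros F J E.
      rewrite <- ln_Rinv by auto. f_equal. apply Rmult_eq_reg_l with (1 - x ^ 2 / INR 1 ^ 2); [|lra].
      rewrite Rinv_r by lra.
      transitivity (PI * x / sin (PI * x) * ((1 - x ^ 2 / INR 1 ^ 2) * cos_ratio x 1)); [ring|].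
      rewrite E. apply Rinv_r. lra.
    + rewrite sum_Sn, <- IH. change (@plus _) with Rplus.
      rewrite <- (cos_ratio_rec x (S n)). rewrite ln_mult by auto. ring.
  - replace (Finite (ln (PI * x / sin (PI * x)))) with (Finite (ln (PI * x / sin (PI * x)) + ln 1))
      by (f_equal; rewrite ln_1; ring).
    apply is_lim_seq_plus'; [apply is_lim_seq_const|].
    apply (is_lim_seq_continuous ln (fun m => cos_ratio x (S m)) 1).
    + apply derivable_continuous_pt. exists (/ 1). apply derivable_pt_lim_ln. lra.
    + apply (is_lim_seq_incr_1 (cos_ratio x)), cos_ratio_lim.
Qed.

(** * The generating function of zeta at even integers *)

Lemma partial_sum_le_Series (a : nat -> R) (N : nat) :
  (forall k, 0 <= a k) -> ex_series a -> sum_n a N <= Series a.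
Proof.
  intros Ha Ea. assert (H := tail_dominated a a N Ea (fun k => Req_le _ _ (Rabs_pos_eq _ (Ha k)))).
  generalize (Rabs_pos (Series a - sum_n a N)); lra.
Qed.

Lemma sum_n_nonneg (a : nat -> R) (N : nat) : (forall k, 0 <= a k) -> 0 <= sum_n a N.
Proof.
  intros Ha. induction N as [|N IH]; [rewrite sum_O; auto|].
  rewrite sum_Sn. change (@plus _) with Rplus. generalize (Ha (S N)); lra.
Qed.

Lemma term_le_partial_sum (a : nat -> R) (N : nat) : (forall k, 0 <= a k) -> a N <= sum_n a N.
Proof.
  intros Ha. destruct N as [|N]; [rewrite sum_O; lra|].
  rewrite sum_Sn. change (@plus _) with Rplus. generalize (sum_n_nonneg a N Ha); lra.
Qed.

Lemma Series_sum_n (a : nat -> nat -> R) (N : nat) :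
  (forall k, ex_series (fun m => a m k)) ->
  ex_series (fun m => sum_n (a m) N) /\
  Series (fun m => sum_n (a m) N) = sum_n (fun k => Series (fun m => a m k)) N.
Proof.
  intros Ha. induction N as [|N [IH1 IH2]].
  - rewrite sum_O. split; [apply ex_series_ext with (fun m => a m 0%nat); auto|apply Series_ext];
    intros m; now rewrite sum_O.
  - rewrite sum_Sn, <- IH2. change (@plus _) with Rplus.
    assert (E : forall m, sum_n (a m) N + a m (S N) = sum_n (a m) (S N))
      by (intros m; now rewrite sum_Sn).
    split.
    + apply (ex_series_ext (V := R_NormedModule)) with (1 := E).
      apply (ex_series_plus (V := R_NormedModule)); auto.
    + rewrite <- Series_plus; auto. apply Series_ext. intros m; now rewrite E.
Qed.

(* Dominated convergence: the partial row sums are bounded by the full row sums. *)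
Lemma is_series_swap (a : nat -> nat -> R) (r : nat -> R) (l : R) :
  (forall m k, 0 <= a m k) -> (forall m, is_series (a m) (r m)) -> is_series r l ->
  is_series (fun k => Series (fun m => a m k)) l.
Proof.
  intros Ha Hr Hl.
  assert (Er : forall m, ex_series (a m)) by (intros m; eexists; apply Hr).
  assert (Sr : forall m, Series (a m) = r m) by (intros m; now apply is_series_unique).
  assert (Ex : ex_series r) by (eexists; apply Hl).
  assert (Ec : forall k, ex_series (fun m => a m k)).
  { intros k. apply ex_series_dominated with r; auto. intros m.
    rewrite Rabs_pos_eq by auto. rewrite <- Sr.
    eapply Rle_trans; [now apply term_le_partial_sum|now apply partial_sum_le_Series]. }
  apply is_series_sum_n.
  apply is_lim_seq_ext with (fun N => Series (fun m => sum_n (a m) N)).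
  { intros N. now apply Series_sum_n. }
  rewrite <- (is_series_unique _ _ Hl).
  apply (tannery eventually (FF := @filter_filter _ _ eventually_filter) (fun m N => sum_n (a m) N) r r); auto.
  - exists 0%nat. intros N _ m. rewrite Rabs_pos_eq by (now apply sum_n_nonneg).
    rewrite <- Sr. now apply partial_sum_le_Series.
  - intros m. rewrite Rabs_pos_eq; [lra|]. rewrite <- Sr.
    eapply Rle_trans; [|now apply (partial_sum_le_Series _ 0)]. now apply sum_n_nonneg.
Qed.

Lemma ln_le_sub (u : R) : 0 < u -> ln u <= u - 1.
Proof.
  intros Hu. generalize (exp_ineq1_le (ln u)). rewrite exp_ln by auto. lra.
Qed.

Lemma ex_series_inv_sq : ex_series (fun m => / INR (S m) ^ 2).
Proof.
  assert (H : ex_series (fun k => 4 * - ln (1 - (/ 2) ^ 2 / INR (S k) ^ 2))).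
  { apply (ex_series_scal_l (V := R_NormedModule) 4).
    eexists. apply is_series_log_sin. lra. }
  apply ex_series_dominated with (1 := H).
  intros k. assert (Hk := INR_S_ge_1 k).
  assert (0 < INR (S k) ^ 2) by (apply pow_lt; lra).
  assert (Hi : 0 < / INR (S k) ^ 2) by (now apply Rinv_0_lt_compat).
  assert (Hi1 : / INR (S k) ^ 2 <= 1) by (rewrite <- Rinv_1; apply Rinv_le_contravar; nra).
  rewrite Rabs_pos_eq by lra.
  generalize (ln_le_sub (1 - (/ 2) ^ 2 / INR (S k) ^ 2)). unfold Rdiv. nra.
Qed.

Definition zeta_even (k : nat) : R := zeta (INR (2 * S k)).

Lemma zeta_evenE (k : nat) : zeta_even k = Series (fun m => / INR (S m) ^ (2 * S k)).
Proof.
  apply Series_ext. intros m. rewrite Rpower_Ropp, Rpower_pow; auto.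
  apply lt_0_INR; lia.
Qed.

Lemma inv_pow_le (m p : nat) : (2 <= p)%nat -> 0 <= / INR (S m) ^ p <= / INR (S m) ^ 2.
Proof.
  intros Hp. assert (Hk := INR_S_ge_1 m).
  split; [apply Rlt_le, Rinv_0_lt_compat, pow_lt; lra|].
  apply Rinv_le_contravar; [apply pow_lt; lra|]. now apply Rle_pow.
Qed.

Definition zeta2 : R := Series (fun m => / INR (S m) ^ 2).

Lemma zeta_even_bound (k : nat) : Rabs (zeta_even k) <= zeta2.
Proof.
  rewrite zeta_evenE. apply Series_dominated; [apply ex_series_inv_sq|].
  intros m. rewrite Rabs_pos_eq; apply inv_pow_le; lia.
Qed.

Lemma is_series_zeta_log (x : R) : 0 < x < 1 ->
  is_series (fun k => zeta_even k / INR (S k) * x ^ (2 * S k)) (ln (PI * x / sin (PI * x))).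
Proof.
  intros Hx.
  assert (Hv : forall m, 0 <= x ^ 2 / INR (S m) ^ 2 < 1).
  { intros m. assert (Hm := inv_pow_le m 2 (le_n _)). assert (Hk := INR_S_ge_1 m).
    assert (/ INR (S m) ^ 2 <= 1) by (rewrite <- Rinv_1; apply Rinv_le_contravar; nra).
    unfold Rdiv. split; nra. }
  assert (H := is_series_swap (fun m k => (x ^ 2 / INR (S m) ^ 2) ^ S k / INR (S k))
     _ _ (fun m k => ltac:(apply Rmult_le_pos; [apply pow_le, Hv|];
            apply Rlt_le, Rinv_0_lt_compat; generalize (INR_S_ge_1 k); lra))
     (fun m => is_series_ln _ (Rabs_def1 _ _ (proj2 (Hv m)) (Rlt_le_trans (-1) 0 _ ltac:(lra) (proj1 (Hv m)))))
     (is_series_log_sin x Hx)).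
  revert H; apply is_series_ext. intros k.
  rewrite zeta_evenE. unfold Rdiv. rewrite Rmult_assoc, <- Series_scal_r.
  apply Series_ext. intros m. assert (Hk := INR_S_ge_1 m). rewrite Rpow_mult_distr, <- pow_inv, <- !pow_mult by lra.
  rewrite pow_inv. ring.
Qed.

Definition bcoef (n k : nat) : R := zeta_even k / (INR (S k) * INR (2 * S k - 1 + 2 * n)).

Definition G (n : nat) (x : R) : R := x ^ 2 * PSeries (bcoef n) (x ^ 2).

Definition ccoef (k : nat) : R := zeta_even k / INR (S k).

Lemma bcoef_bound (n k : nat) : Rabs (bcoef n k) <= zeta2.
Proof.
  unfold bcoef. eapply Rle_trans; [apply Rabs_div_le|apply zeta_even_bound].
  replace (2 * S k - 1 + 2 * n)%nat with (S (2 * k + 2 * n)) by lia.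
  assert (H1 := INR_S_ge_1 k). assert (H2 := INR_S_ge_1 (2 * k + 2 * n)). nra.
Qed.

Lemma ccoef_bound (k : nat) : Rabs (ccoef k) <= zeta2.
Proof.
  unfold ccoef. eapply Rle_trans; [apply Rabs_div_le, INR_S_ge_1|apply zeta_even_bound].
Qed.

Lemma sq_lt_1 (x : R) : Rabs x < 1 -> Rabs (x ^ 2) < 1.
Proof.
  intros Hx. rewrite <- RPow_abs. generalize (Rabs_pos x). nra.
Qed.

Lemma is_series_even (a : nat -> R) (M x : R) :
  (forall k, Rabs (a k) <= M) -> Rabs x < 1 ->
  is_series (fun k => a k * x ^ (2 * S k)) (x ^ 2 * PSeries a (x ^ 2)).
Proof.
  intros Ha Hx.
  assert (H := PSeries_correct a (x ^ 2)
    (CV_radius_inside _ _ (CV_radius_gt a M _ Ha (sq_lt_1 x Hx)))).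
  apply is_pseries_R, (is_series_scal_l (x ^ 2)) in H.
  revert H. apply is_series_ext. intros k.
  rewrite pow_mult. change (@scal _ _) with Rmult. simpl. ring.
Qed.

Lemma ln_sin_PSeries (x : R) : 0 < x < 1 ->
  ln (PI * x / sin (PI * x)) = x ^ 2 * PSeries ccoef (x ^ 2).
Proof.
  intros Hx. rewrite <- (is_series_unique _ _ (is_series_zeta_log x Hx)).
  apply is_series_unique, is_series_even with zeta2; [apply ccoef_bound|].
  rewrite Rabs_pos_eq; lra.
Qed.

Lemma PSeries_bcoef_ode (p : nat) (u : R) : Rabs u < 1 ->
  (2 * INR p + 3) * PSeries (bcoef (S p)) u + 2 * u * PSeries (PS_derive (bcoef (S p))) u
  = PSeries ccoef u.
Proof.
  intros Hu. set (b := bcoef (S p)).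
  assert (Hc : Rbar_lt (Rabs u) (CV_radius b))
    by (apply CV_radius_gt with zeta2; auto; apply bcoef_bound).
  assert (E1 : ex_pseries b u) by (now apply CV_radius_inside).
  assert (E2 : ex_pseries (PS_derive b) u)
    by (apply CV_radius_inside; now rewrite CV_radius_derive).
  rewrite Rmult_assoc, <- PSeries_incr_1, <- !PSeries_scal, <- PSeries_plus.
  - apply PSeries_ext. intros k. unfold PS_plus, PS_scal.
    change (@plus _) with Rplus. change (@scal _ _) with Rmult. unfold b.
    assert (F : forall k, INR (2 * S k - 1 + 2 * S p) = 2 * INR k + 2 * INR p + 3).
    { intros j. replace (2 * S j - 1 + 2 * S p)%nat with (2 * j + 2 * p + 3)%nat by lia.
      rewrite !plus_INR, !mult_INR. simpl; ring. }
    generalize (pos_INR k) (pos_INR p); intros.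
    destruct k as [|k]; unfold PS_incr_1, PS_derive, bcoef, ccoef; rewrite F.
    + change (@zero _) with 0. simpl INR. field. lra.
    + rewrite !S_INR in *. field. lra.
  - apply ex_pseries_scal; [apply Rmult_comm|auto].
  - apply ex_pseries_scal; [apply Rmult_comm|]. now apply ex_pseries_incr_1.
Qed.

Lemma is_derive_pow_G (p : nat) (x : R) : 0 < x < 1 ->
  is_derive (fun t => t ^ (2 * p + 1) * G (S p) t) x (x ^ (2 * p) * ln (PI * x / sin (PI * x))).
Proof.
  intros Hx.
  assert (Hu : Rabs (x ^ 2) < 1) by (apply sq_lt_1; rewrite Rabs_pos_eq; lra).
  assert (Hd := is_derive_PSeries (bcoef (S p)) (x ^ 2)
            (CV_radius_gt _ _ _ (bcoef_bound (S p)) Hu)).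
  rewrite ln_sin_PSeries by auto. rewrite <- (PSeries_bcoef_ode p) by auto.
  apply is_derive_ext with (fun t => t ^ (2 * p + 3) * PSeries (bcoef (S p)) (t ^ 2)).
  { intros t. unfold G. rewrite !pow_add. simpl; ring. }
  auto_derive.
  - repeat split; auto. eexists. apply Hd.
  - change (x * (x * 1)) with (x ^ 2).
    change (Derive (fun s => PSeries ?a s)) with (Derive (PSeries a)).
    rewrite (is_derive_unique _ _ _ Hd).
    replace (p + (p + 0) + 3)%nat with (2 * p + 3)%nat by lia.
    replace (pred (2 * p + 3)) with (2 * p + 2)%nat by lia.
    rewrite !plus_INR, mult_INR, !pow_add. simpl; ring.
Qed.

(** * Clausen functions *)

Definition sin_series (p : nat) (x : R) : R := Series (fun k => sin (INR (S k) * x) / INR (S k) ^ p).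
Definition cos_series (p : nat) (x : R) : R := Series (fun k => cos (INR (S k) * x) / INR (S k) ^ p).

Lemma Cl_even (j : nat) (x : R) : Cl (2 * S j) x = sin_series (2 * S j) x.
Proof.
  assert (E : Nat.even (2 * S j) = true) by (apply Nat.even_spec; exists (S j); lia).
  unfold sin_series. replace (2 * S j)%nat with (S (S (2 * j))) in * by lia.
  unfold Cl. now rewrite E.
Qed.

Lemma Cl_odd (j : nat) (x : R) : Cl (2 * S j + 1) x = cos_series (2 * S j + 1) x.
Proof.
  assert (E : Nat.even (2 * S j + 1) = false).
  { rewrite <- Nat.negb_odd. replace (Nat.odd _) with true; auto.
    symmetry; apply Nat.odd_spec; exists (S j); lia. }
  unfold cos_series. replace (2 * S j + 1)%nat with (S (S (2 * j + 1))) in * by lia.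
  unfold Cl. now rewrite E.
Qed.

Lemma div_pow_bound (a : R) (k p : nat) : Rabs a <= 1 -> (2 <= p)%nat ->
  Rabs (a / INR (S k) ^ p) <= / INR (S k) ^ 2.
Proof.
  intros Ha Hp. assert (H := inv_pow_le k p Hp).
  unfold Rdiv. rewrite Rabs_mult, (Rabs_pos_eq (/ _)) by lra.
  generalize (Rabs_pos a); nra.
Qed.

Lemma Rabs_sin_1 (y : R) : Rabs (sin y) <= 1.
Proof. apply Rabs_le, SIN_bound. Qed.

Lemma Rabs_cos_1 (y : R) : Rabs (cos y) <= 1.
Proof. apply Rabs_le, COS_bound. Qed.

Lemma ex_series_inv_sq_bound (a : nat -> R) :
  (forall k, Rabs (a k) <= / INR (S k) ^ 2) -> ex_series a.
Proof. apply ex_series_dominated, ex_series_inv_sq. Qed.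

Lemma is_derive_sin_series (p : nat) (x : R) : (2 <= p)%nat ->
  is_derive (sin_series (S p)) x (cos_series p x).
Proof.
  intros Hp. apply (is_derive_Series _ (fun k x => cos (INR (S k) * x) / INR (S k) ^ p))
    with (fun k => / INR (S k) ^ 2).
  - intros y. apply ex_series_inv_sq_bound. intros k. apply div_pow_bound; [apply Rabs_sin_1|lia].
  - apply ex_series_inv_sq.
  - intros k y. assert (Hk := INR_S_ge_1 k). assert (0 < INR (S k) ^ p) by (apply pow_lt; lra).
    set (K := INR (S k)) in *. auto_derive; auto. simpl pow. field. lra.
  - intros k y. apply div_pow_bound; auto using Rabs_cos_1.
Qed.

Lemma is_derive_cos_series (p : nat) (x : R) : (2 <= p)%nat ->
  is_derive (cos_series (S p)) x (- sin_series p x).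
Proof.
  intros Hp. unfold sin_series. rewrite <- Series_opp.
  apply (is_derive_Series _ (fun k x => - (sin (INR (S k) * x) / INR (S k) ^ p)))
    with (fun k => / INR (S k) ^ 2).
  - intros y. apply ex_series_inv_sq_bound. intros k. apply div_pow_bound; [apply Rabs_cos_1|lia].
  - apply ex_series_inv_sq.
  - intros k y. assert (Hk := INR_S_ge_1 k). assert (0 < INR (S k) ^ p) by (apply pow_lt; lra).
    set (K := INR (S k)) in *. auto_derive; auto. simpl pow. field. lra.
  - intros k y. rewrite Rabs_Ropp. apply div_pow_bound; auto using Rabs_sin_1.
Qed.

Lemma sin_series_lim_0 (p : nat) : (2 <= p)%nat ->
  filterlim (sin_series p) (locally 0) (locally 0).
Proof.
  intros Hp.
  replace 0 with (Series (fun k => sin (INR (S k) * 0) / INR (S k) ^ p)) at 2.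
  2:{ transitivity (0 * Series (fun k => / INR (S k) ^ p)); [|ring].
      rewrite <- Series_scal_l. apply Series_ext. intros k. rewrite Rmult_0_r, sin_0. reflexivity. }
  apply (tannery (locally 0) (FF := @filter_filter _ _ (locally_filter 0))
     (fun k x => sin (INR (S k) * x) / INR (S k) ^ p) _ (fun k => / INR (S k) ^ 2)).
  - apply ex_series_inv_sq.
  - intros k. apply (ex_derive_continuous (V := R_NormedModule)
       (fun x => sin (INR (S k) * x) / INR (S k) ^ p)).
    set (K := INR (S k)). auto_derive; auto.
  - apply filter_forall. intros x k. apply div_pow_bound; auto using Rabs_sin_1.
  - intros k. apply div_pow_bound; auto using Rabs_sin_1.
Qed.

Lemma cos_series_bound (p : nat) (x : R) : (2 <= p)%nat -> Rabs (cos_series p x) <= zeta2.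
Proof.
  intros Hp. apply Series_dominated; [apply ex_series_inv_sq|].
  intros k. apply div_pow_bound; auto using Rabs_cos_1.
Qed.

Definition rseq (n : nat) : R := 1 - / INR (S (S n)).

Lemma rseq_bound (n : nat) : / 2 <= rseq n < 1.
Proof.
  unfold rseq. assert (H := INR_S_ge_1 n). rewrite S_INR.
  split; [|generalize (Rinv_0_lt_compat (INR (S n) + 1)); lra].
  generalize (Rinv_le_contravar 2 (INR (S n) + 1)); lra.
Qed.

Lemma rseq_lim : is_lim_seq rseq 1.
Proof.
  replace (Finite 1) with (Finite (1 - 0)) by (f_equal; ring).
  apply is_lim_seq_minus'; [apply is_lim_seq_const|].
  apply is_lim_seq_ext with (fun n => / INR (n + 2)).
  { intros n. do 2 f_equal. lia. }
  apply (is_lim_seq_incr_n (fun m => / INR m) 2).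
  replace (Finite 0) with (Rbar_inv p_infty) by reflexivity.
  apply is_lim_seq_inv; [apply is_lim_seq_INR|discriminate].
Qed.

Definition abel_sin (n : nat) (x : R) : R :=
  Series (fun k => rseq n ^ S k * sin (INR (S k) * x) / INR (S k) ^ 2).

Lemma rseq_pow_bound (n k : nat) : 0 <= rseq n ^ k <= 1.
Proof.
  assert (H := rseq_bound n). split; [apply pow_le; lra|].
  rewrite <- (pow1 k). apply pow_incr; lra.
Qed.

Lemma abel_sin_bound (n k : nat) (x : R) :
  Rabs (rseq n ^ S k * sin (INR (S k) * x) / INR (S k) ^ 2) <= / INR (S k) ^ 2.
Proof.
  apply div_pow_bound; [|lia]. rewrite Rabs_mult. assert (H := rseq_pow_bound n (S k)).
  rewrite Rabs_pos_eq by lra. generalize (Rabs_sin_1 (INR (S k) * x)) (Rabs_pos (sin (INR (S k) * x))).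
  nra.
Qed.

Lemma abel_sin_unif (eps : R) : 0 < eps ->
  eventually (fun n => forall x, Rabs (abel_sin n x - sin_series 2 x) < eps).
Proof.
  intros Heps.
  assert (H : is_lim_seq (fun n => Series (fun k => (1 - rseq n ^ S k) * / INR (S k) ^ 2)) 0).
  { replace 0 with (Series (fun k => 0 * / INR (S k) ^ 2)) by (rewrite Series_scal_l; ring).
    apply (tannery eventually (FF := @filter_filter _ _ eventually_filter)
      (fun k n => (1 - rseq n ^ S k) * / INR (S k) ^ 2) _ (fun k => / INR (S k) ^ 2)).
    - apply ex_series_inv_sq.
    - intros k.
      apply (is_lim_seq_mult' (fun n => 1 - rseq n ^ S k) (fun _ => / INR (S k) ^ 2) 0);
        [|apply is_lim_seq_const].
      replace 0 with (1 - 1 ^ S k) by (rewrite pow1; ring).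
      apply is_lim_seq_minus'; [apply is_lim_seq_const|].
      apply (is_lim_seq_continuous (fun t => t ^ S k) rseq 1); [|apply rseq_lim].
      apply derivable_continuous_pt, derivable_pt_pow.
    - exists 0%nat. intros n _ k. apply (div_pow_bound (1 - rseq n ^ S k) k 2); [|lia].
      assert (Hr := rseq_pow_bound n (S k)). apply Rabs_le; lra.
    - intros k. rewrite Rmult_0_l, Rabs_R0. apply inv_pow_le; lia. }
  destruct (proj1 (filterlim_R (FF := @filter_filter _ _ eventually_filter) _ _ _) H eps Heps) as [N HN].
  exists N. intros n Hn x.
  eapply Rle_lt_trans; [|apply (HN n Hn)]. rewrite Rminus_0_r.
  eapply Rle_trans; [|apply RRle_abs].
  unfold abel_sin, sin_series. rewrite <- Series_minus.
  - apply Series_dominated.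
    + apply ex_series_inv_sq_bound. intros k. apply (div_pow_bound (1 - rseq n ^ S k) k 2); [|lia].
      assert (Hr := rseq_pow_bound n (S k)). apply Rabs_le; lra.
    + intros k. assert (Hr := rseq_pow_bound n (S k)). assert (Hi := inv_pow_le k 2 (le_n _)).
      replace (_ - _) with (- (sin (INR (S k) * x) * ((1 - rseq n ^ S k) * / INR (S k) ^ 2)))
        by (unfold Rdiv; ring).
      rewrite Rabs_Ropp, Rabs_mult, (Rabs_pos_eq (_ * / _)) by (apply Rmult_le_pos; lra).
      rewrite <- (Rmult_1_l ((1 - _) * _)) at 2. apply Rmult_le_compat_r; [|apply Rabs_sin_1].
      apply Rmult_le_pos; lra.
  - apply ex_series_inv_sq_bound. intros k; apply abel_sin_bound.
  - apply ex_series_inv_sq_bound. intros k; apply div_pow_bound; auto using Rabs_sin_1.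
Qed.

Lemma is_derive_abel_sin (n : nat) (x : R) :
  is_derive (abel_sin n) x (- / 2 * ln (1 - 2 * rseq n * cos x + rseq n ^ 2)).
Proof.
  assert (Hr := rseq_bound n).
  assert (Hr1 : Rabs (rseq n) < 1) by (rewrite Rabs_pos_eq; lra).
  rewrite <- (is_series_unique _ _ (is_series_log_cos x _ Hr1)).
  apply (is_derive_Series (fun k x => rseq n ^ S k * sin (INR (S k) * x) / INR (S k) ^ 2)
    (fun k x => rseq n ^ S k * cos (INR (S k) * x) / INR (S k))
    (fun k => rseq n ^ S k)).
  - intros y. apply ex_series_inv_sq_bound. intros k; apply abel_sin_bound.
  - apply (ex_series_incr_1 (fun k => rseq n ^ k)), ex_series_geom, Hr1.
  - intros k y. assert (Hk := INR_S_ge_1 k).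
    set (K := INR (S k)) in *. set (q := rseq n ^ S k). auto_derive; auto. field. lra.
  - intros k y. assert (H := rseq_pow_bound n (S k)).
    eapply Rle_trans; [apply Rabs_div_le, INR_S_ge_1|].
    rewrite Rabs_mult, Rabs_pos_eq by lra.
    generalize (Rabs_cos_1 (INR (S k) * y)); nra.
Qed.

Lemma ln_lipschitz (A B d : R) : 0 < d -> d <= A -> d <= B -> Rabs (ln A - ln B) <= Rabs (A - B) / d.
Proof.
  assert (H : forall A B, 0 < d -> d <= A -> d <= B -> ln A - ln B <= Rabs (A - B) / d).
  { clear. intros A B Hd HA HB. rewrite <- ln_div by lra.
    eapply Rle_trans; [apply ln_le_sub, Rdiv_lt_0_compat; lra|].
    replace (A / B - 1) with ((A - B) / B) by (field; lra).
    apply Rle_trans with (Rabs (A - B) / B).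
    - apply Rmult_le_compat_r; [apply Rlt_le, Rinv_0_lt_compat; lra|apply RRle_abs].
    - apply Rmult_le_compat_l; [apply Rabs_pos|]. apply Rinv_le_contravar; lra. }
  intros Hd HA HB. apply Rabs_le. assert (H1 := H A B Hd HA HB). assert (H2 := H B A Hd HB HA).
  rewrite Rabs_minus_sym in H2. lra.
Qed.

Lemma one_minus_cos (y : R) : 1 - cos y = 2 * sin (y / 2) ^ 2.
Proof. replace y with (2 * (y / 2)) at 1 by field. rewrite cos_2a_sin. ring. Qed.

Lemma sin_half_pos (y : R) : 0 < y < 2 * PI -> 0 < sin (y / 2).
Proof. intros Hy. apply sin_gt_0; lra. Qed.

Lemma log_arg_unif (c0 : R) (eps : R) : c0 < 1 -> 0 < eps ->
  eventually (fun n => forall x, cos x < c0 ->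
    Rabs (- / 2 * ln (1 - 2 * rseq n * cos x + rseq n ^ 2) - - / 2 * ln (2 - 2 * cos x)) < eps).
Proof.
  intros Hc Heps. set (d := 1 - c0).
  assert (He : 0 < eps * d / 5) by (unfold d; apply Rdiv_lt_0_compat; [apply Rmult_lt_0_compat|]; lra).
  destruct (proj1 (filterlim_R (FF := @filter_filter _ _ eventually_filter) _ _ _) rseq_lim _ He)
    as [N HN].
  exists N. intros n Hn x Hx. assert (Hr := HN n Hn). assert (Hb := rseq_bound n).
  set (r := rseq n) in *. assert (Hcx := COS_bound x). set (c := cos x) in *.
  rewrite Rabs_minus_sym, Rabs_pos_eq in Hr by lra.
  replace (_ - _) with (- / 2 * (ln (1 - 2 * r * c + r ^ 2) - ln (2 - 2 * c))) by ring.
  rewrite Rabs_mult, Rabs_Ropp, (Rabs_pos_eq (/ 2)) by lra.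
  assert (HL := ln_lipschitz (1 - 2 * r * c + r ^ 2) (2 - 2 * c) d).
  assert (HA : Rabs (1 - 2 * r * c + r ^ 2 - (2 - 2 * c)) <= 5 * (1 - r)) by (apply Rabs_le; nra).
  assert (Hd : Rabs (1 - 2 * r * c + r ^ 2 - (2 - 2 * c)) / d < eps).
  { apply Rmult_lt_reg_r with d; [unfold d; lra|]. unfold Rdiv.
    rewrite Rmult_assoc, Rinv_l by (unfold d; lra). lra. }
  assert (HL' : Rabs (ln (1 - 2 * r * c + r ^ 2) - ln (2 - 2 * c)) < eps).
  { eapply Rle_lt_trans; [apply HL|exact Hd]; unfold d; nra. }
  generalize (Rabs_pos (ln (1 - 2 * r * c + r ^ 2) - ln (2 - 2 * c))); lra.
Qed.

Lemma is_derive_Cl_2 (y : R) : 0 < y < 2 * PI -> is_derive (Cl 2) y (Cl 1 y).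
Proof.
  intros Hy. assert (Hs := sin_half_pos y Hy).
  assert (Hc1 : cos y < 1).
  { assert (H := one_minus_cos y). assert (0 < sin (y / 2) ^ 2) by (now apply pow_lt). lra. }
  set (c0 := (1 + cos y) / 2).
  destruct (proj1 (filterlim_R (FF := @filter_filter _ _ (locally_filter y)) _ _ _)
     (proj1 (continuity_pt_filterlim cos y) (continuity_cos y)) (c0 - cos y)) as [d Hd].
  { unfold c0; lra. }
  assert (HD : forall x, y - d < x < y + d -> cos x < c0).
  { intros x Hx. assert (H := Hd x ltac:(apply Rabs_def1; simpl; unfold minus, plus, opp; simpl; lra)).
    apply Rabs_def2 in H. lra. }
  assert (L1 : forall x, Lim_seq (fun n => abel_sin n x) = sin_series 2 x).
  { intros x. apply is_lim_seq_unique.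
    apply (filterlim_R (FF := @filter_filter _ _ eventually_filter) eventually).
    intros eps He. generalize (abel_sin_unif eps He). apply filter_imp; auto. }
  assert (L2 : forall x, y - d < x < y + d ->
     Lim_seq (fun n => Derive (abel_sin n) x) = - / 2 * ln (2 - 2 * cos x)).
  { intros x Hx. apply is_lim_seq_unique.
    apply (filterlim_R (FF := @filter_filter _ _ eventually_filter) eventually).
    intros eps He. generalize (log_arg_unif c0 eps ltac:(unfold c0; lra) He). apply filter_imp.
    intros n Hn. rewrite (is_derive_unique _ _ _ (is_derive_abel_sin n x)). auto. }
  assert (H : is_derive (fun x => real (Lim_seq (fun n => abel_sin n x))) y
                (real (Lim_seq (fun n => Derive (abel_sin n) y)))).
  { apply (CVU_Derive abel_sin (fun x => y - d < x < y + d)).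
    - apply open_and; [apply open_gt|apply open_lt].
    - intros u v w Hu Hv Hw. lra.
    - intros eps. generalize (abel_sin_unif eps (cond_pos eps)). apply filter_imp.
      intros n Hn x _. rewrite L1. apply Hn.
    - intros n x _. eexists. apply is_derive_abel_sin.
    - intros n x _.
      apply continuity_pt_ext with (fun x => - / 2 * ln (1 - 2 * rseq n * cos x + rseq n ^ 2)).
      { intros t. symmetry. apply is_derive_unique, is_derive_abel_sin. }
      assert (Hr := rseq_bound n).
      assert (Hp := log_arg_pos x (rseq n) ltac:(rewrite Rabs_pos_eq; lra)).
      eapply is_derive_continuity_pt. auto_derive; [simpl in *; lra|reflexivity].
    - intros eps. generalize (log_arg_unif c0 eps ltac:(unfold c0; lra) (cond_pos eps)).
      apply filter_imp. intros n Hn x Hx. rewrite L2 by auto.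
      rewrite (is_derive_unique _ _ _ (is_derive_abel_sin n x)). auto.
    - destruct d; simpl; lra. }
  rewrite L2 in H by (destruct d; simpl; lra).
  replace (Cl 1 y) with (- / 2 * ln (2 - 2 * cos y)).
  - revert H. apply is_derive_ext. intros t. rewrite L1. symmetry; apply (Cl_even 0).
  - unfold Cl. rewrite Rabs_pos_eq by lra.
    replace (2 - 2 * cos y) with ((2 * sin (y / 2)) * (2 * sin (y / 2)))
      by (generalize (one_minus_cos y); simpl; lra).
    rewrite ln_mult by lra. lra.
Qed.

Lemma is_derive_Cl_1 (y : R) : 0 < y < 2 * PI ->
  is_derive (Cl 1) y (- (cos (y / 2) / (2 * sin (y / 2)))).
Proof.
  intros Hy. assert (Hs := sin_half_pos y Hy).
  apply is_derive_ext_loc with (fun t => - ln (2 * sin (t / 2))).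
  - assert (Ho : locally y (fun t => 0 < t < 2 * PI))
      by (apply (open_and _ _ (open_gt 0) (open_lt (2 * PI)) y Hy)).
    revert Ho. apply filter_imp. intros t Ht. unfold Cl.
    rewrite Rabs_pos_eq; auto. generalize (sin_half_pos t Ht); lra.
  - auto_derive; [lra|]. change (y * / 2) with (y / 2). field. lra.
Qed.

Lemma is_derive_Cl_even (j : nat) (y : R) : 0 < y < 2 * PI ->
  is_derive (Cl (2 * S j)) y (Cl (2 * j + 1) y).
Proof.
  intros Hy. destruct j as [|j]; [now apply is_derive_Cl_2|].
  rewrite Cl_odd. apply is_derive_ext with (sin_series (2 * S (S j))).
  { intros t; symmetry; apply Cl_even. }
  replace (2 * S (S j))%nat with (S (2 * S j + 1)) by lia. apply is_derive_sin_series; lia.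
Qed.

Lemma is_derive_Cl_odd (j : nat) (y : R) :
  is_derive (Cl (2 * S j + 1)) y (- Cl (2 * S j) y).
Proof.
  rewrite Cl_even. apply is_derive_ext with (cos_series (2 * S j + 1)).
  { intros t; symmetry; apply Cl_odd. }
  replace (2 * S j + 1)%nat with (S (2 * S j)) by lia. apply is_derive_cos_series; lia.
Qed.

(** * The Clausen sum *)

Definition monom (k : nat) (y : R) : R := y ^ k / INR (fact k).

Definition monom' (k : nat) (y : R) : R := match k with O => 0 | S j => monom j y end.

Fixpoint cl_poly (m e : nat) (y : R) : R :=
  match m with
  | O => 0
  | S j => cl_poly j (S (S e)) y
           + (-1) ^ m * (Cl (2 * m) y * monom e y - Cl (2 * j + 1) y * monom (S e) y)
  end.

Lemma is_derive_monom (k : nat) (y : R) : is_derive (monom k) y (monom' k y).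
Proof.
  assert (Hf := INR_fact_lt_0 k).
  unfold monom, monom'. destruct k as [|k].
  - apply is_derive_ext with (fun _ => 1); [intros t; simpl; field|].
    apply (is_derive_const (V := R_NormedModule)).
  - assert (Hf' := INR_fact_lt_0 k). unfold monom.
    assert (E : INR (fact (S k)) = INR (S k) * INR (fact k)) by (now rewrite <- mult_INR).
    rewrite E in *. assert (Hk := INR_S_ge_1 k).
    set (K := INR (S k)) in *. set (f := INR (fact k)) in *.
    auto_derive; auto. change (1 * (K * y ^ k) * / (K * f) = y ^ k / f). field. lra.
Qed.

Lemma is_derive_mult_R (f g : R -> R) (x a b : R) :
  is_derive f x a -> is_derive g x b -> is_derive (fun t => f t * g t) x (a * g x + f x * b).
Proof.
  intros Hf Hg. exact (is_derive_mult f g x a b Hf Hg Rmult_comm).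
Qed.

Lemma is_derive_cl_poly (m e : nat) (y : R) : 0 < y < 2 * PI ->
  is_derive (cl_poly (S m) e) y
    (- (cos (y / 2) / (2 * sin (y / 2))) * monom (e + 2 * m + 1) y
     + (-1) ^ (S m) * (Cl (2 * S m) y * monom' e y)).
Proof.
  intros Hy. revert e.
  assert (Hstep : forall m e d, is_derive (Cl (2 * m + 1)) y d ->
     is_derive (fun t => (-1) ^ S m * (Cl (2 * S m) t * monom e t - Cl (2 * m + 1) t * monom (S e) t)) y
       ((-1) ^ S m * (Cl (2 * S m) y * monom' e y - d * monom (S e) y))).
  { clear m. intros m e d Hd. apply is_derive_scal.
    replace (_ - _) with (minus (Cl (2 * m + 1) y * monom e y + Cl (2 * S m) y * monom' e y)
         (d * monom (S e) y + Cl (2 * m + 1) y * monom e y))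
      by (unfold minus, plus, opp; simpl; ring).
    apply (is_derive_minus (V := R_NormedModule)); apply is_derive_mult_R; auto.
    - now apply is_derive_Cl_even.
    - apply is_derive_monom.
    - apply (is_derive_monom (S e)). }
  induction m as [|m IH]; intros e.
  - assert (H := Hstep 0%nat e _ (is_derive_Cl_1 y Hy)).
    apply (is_derive_ext (fun t => (-1) ^ 1 * (Cl (2 * 1) t * monom e t - Cl (2 * 0 + 1) t * monom (S e) t))).
    { intros t. symmetry. apply (Rplus_0_l (_ * _)). }
    replace (e + 2 * 0 + 1)%nat with (S e) by lia.
    replace (_ + _) with ((-1) ^ 1 * (Cl (2 * 1) y * monom' e y
        - - (cos (y / 2) / (2 * sin (y / 2))) * monom (S e) y)) by ring. exact H.
  - assert (H := Hstep (S m) e _ (is_derive_Cl_odd m y)).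
    assert (H2 := is_derive_plus _ _ _ _ _ (IH (S (S e))) H).
    replace (e + 2 * S m + 1)%nat with (S (S e) + 2 * m + 1)%nat by lia.
    replace (_ + _) with (plus (- (cos (y / 2) / (2 * sin (y / 2))) * monom (S (S e) + 2 * m + 1) y
        + (-1) ^ S m * (Cl (2 * S m) y * monom' (S (S e)) y))
       ((-1) ^ S (S m) * (Cl (2 * S (S m)) y * monom' e y - - Cl (2 * S m) y * monom (S e) y))).
    + exact H2.
    + change (@plus _) with Rplus. eq_R. simpl monom'. rewrite <- !tech_pow_Rmult. ring.
Qed.

Lemma cl_poly_sum (m e : nat) (y : R) :
  cl_poly m e y = sum_n_m (fun j => (-1) ^ j * (Cl (2 * j) y * monom (e + 2 * (m - j)) y
                     - Cl (2 * j - 1) y * monom (S (e + 2 * (m - j))) y)) 1 m.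
Proof.
  revert e; induction m as [|m IH]; intros e.
  - rewrite sum_n_m_zero by lia. reflexivity.
  - rewrite sum_n_Sm by lia. change (@plus _) with Rplus.
    change (cl_poly (S m) e y) with (cl_poly m (S (S e)) y
           + (-1) ^ S m * (Cl (2 * S m) y * monom e y - Cl (2 * m + 1) y * monom (S e) y)).
    rewrite Nat.sub_diag. replace (e + 2 * 0)%nat with e by lia.
    replace (2 * S m - 1)%nat with (2 * m + 1)%nat by lia.
    f_equal. rewrite IH. apply sum_n_m_ext_loc. intros j Hj.
    replace (e + 2 * (S m - j))%nat with (S (S e) + 2 * (m - j))%nat by lia. reflexivity.
Qed.

Lemma clterm_cl_poly (p : nat) (y : R) : y <> 0 ->
  y ^ (2 * p + 1) * clterm (S p) y = INR (fact (2 * p)) * cl_poly (S p) 0 y.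
Proof.
  intros Hy. unfold clterm, sum1. replace (2 * S p - 2)%nat with (2 * p)%nat by lia.
  rewrite cl_poly_sum.
  rewrite <- Rmult_assoc, (Rmult_comm (y ^ _)), Rmult_assoc. f_equal.
  rewrite <- (sum_n_m_mult_l (K := R_Ring)). apply sum_n_m_ext_loc.
  intros j Hj. change (@mult _) with Rmult.
  set (i := (S p - j)%nat). replace (2 * S p + 1 - 2 * j)%nat with (S (2 * i)) by (unfold i; lia).
  destruct j as [|j]; [lia|].
  replace (2 * S j - 1)%nat with (2 * j + 1)%nat by lia.
  replace (2 * p + 1)%nat with (2 * i + (2 * j + 1))%nat by (unfold i; lia).
  unfold monom. rewrite Nat.add_0_l.
  assert (E : INR (fact (S (2 * i))) = INR (S (2 * i)) * INR (fact (2 * i))) by (now rewrite <- mult_INR).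
  rewrite E. assert (H1 := INR_fact_lt_0 (2 * i)). assert (H2 := INR_S_ge_1 (2 * i)).
  assert (H3 : y ^ (2 * j + 1) <> 0) by (now apply pow_nonzero).
  rewrite pow_add. change (y ^ S (2 * i)) with (y * y ^ (2 * i)).
  set (a := INR (S (2 * i))) in *. set (f := INR (fact (2 * i))) in *.
  set (b := y ^ (2 * j + 1)) in *. eq_R. field. repeat split; lra.
Qed.

Lemma filterlim_within (D : R -> Prop) (f : R -> R) (x l : R) :
  filterlim f (locally x) (locally l) -> filterlim f (within D (locally x)) (locally l).
Proof.
  intros H P HP. apply (filter_le_within (F := locally x) D). now apply H.
Qed.

Lemma continuous_at_right (f : R -> R) (x : R) :
  (forall t, ex_derive f t) -> filterlim f (at_right x) (locally (f x)).
Proof.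
  intros H. apply filterlim_within.
  apply (ex_derive_continuous (V := R_NormedModule)), H.
Qed.

Lemma filterlim_mult_R (F : (R -> Prop) -> Prop) {FF : Filter F} (f g : R -> R) (a b : R) :
  filterlim f F (locally a) -> filterlim g F (locally b) ->
  filterlim (fun x => f x * g x) F (locally (a * b)).
Proof.
  intros Hf Hg. exact (filterlim_comp_2 _ _ _ Hf Hg (filterlim_mult (K := R_AbsRing) a b)).
Qed.

Lemma filterlim_plus_R (F : (R -> Prop) -> Prop) {FF : Filter F} (f g : R -> R) (a b : R) :
  filterlim f F (locally a) -> filterlim g F (locally b) ->
  filterlim (fun x => f x + g x) F (locally (a + b)).
Proof.
  intros Hf Hg. exact (filterlim_comp_2 _ _ _ Hf Hg (filterlim_plus (V := R_NormedModule) a b)).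
Qed.

Lemma filterlim_bounded_mult (F : (R -> Prop) -> Prop) {FF : Filter F} (f g : R -> R) (M : R) :
  0 < M -> (forall x, Rabs (f x) <= M) -> filterlim g F (locally 0) ->
  filterlim (fun x => f x * g x) F (locally 0).
Proof.
  intros HM Hf Hg. apply filterlim_R; auto. intros eps He.
  assert (Hg' := proj1 (filterlim_R _ _ _) Hg (eps / M) (Rdiv_lt_0_compat _ _ He HM)).
  revert Hg'. apply filter_imp. intros x Hx. rewrite Rminus_0_r in *.
  rewrite Rabs_mult. apply Rle_lt_trans with (M * Rabs (g x)).
  - apply Rmult_le_compat_r; [apply Rabs_pos|auto].
  - apply Rmult_lt_reg_l with (/ M); [now apply Rinv_0_lt_compat|].
    rewrite <- Rmult_assoc, Rinv_l, Rmult_1_l by lra. unfold Rdiv in Hx; lra.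
Qed.

Lemma Cl_1_bound (s : R) : 0 < s <= 1 -> Rabs (s ^ 2 * Cl 1 (s ^ 2)) <= 3 * s.
Proof.
  intros Hs. set (y := s ^ 2).
  assert (Hy : 0 < y <= 1) by (unfold y; nra).
  assert (HPI := PI2_3_2). unfold PI2 in HPI.
  assert (Hu : sin (y / 2) < y / 2) by (apply sin_lt_x; lra).
  assert (Hl : y / 4 <= sin (y / 2)).
  { destruct (mult_cos_le_sin (y / 2)) as [_ H]; [lra|].
    assert (Hc := one_minus_cos_le (y / 4)). replace (2 * (y / 4)) with (y / 2) in Hc by field.
    nra. }
  assert (Es : Cl 1 y = - ln (2 * sin (y / 2))) by (unfold Cl; rewrite Rabs_pos_eq; lra).
  rewrite Es.
  assert (H1 : ln (2 * sin (y / 2)) <= 0).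
  { rewrite <- ln_1. apply ln_le; lra. }
  assert (H2 : ln (y / 2) <= ln (2 * sin (y / 2))) by (apply ln_le; lra).
  assert (H3 : - ln (y / 2) <= 1 + 2 / s).
  { replace (- ln (y / 2)) with (ln 2 + (ln (/ s) + ln (/ s))).
    - assert (L2 := ln_le_sub 2 ltac:(lra)).
      assert (Hi : 0 < / s) by (apply Rinv_0_lt_compat; lra).
      assert (Ls := ln_le_sub (/ s) Hi). unfold Rdiv. lra.
    - rewrite ln_div, !ln_Rinv by lra. unfold y. replace (s ^ 2) with (s * s) by ring.
      rewrite ln_mult by lra. ring. }
  rewrite Rabs_pos_eq by (apply Rmult_le_pos; lra).
  apply Rle_trans with (y * (1 + 2 / s)); [apply Rmult_le_compat_l; lra|].
  unfold y. replace (s ^ 2 * (1 + 2 / s)) with (s ^ 2 + 2 * s) by (field; lra). nra.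
Qed.

Lemma Cl_1_lim : filterlim (fun y => y * Cl 1 y) (at_right 0) (locally 0).
Proof.
  apply filterlim_R; [apply within_filter, locally_filter|]. intros eps He.
  set (d := Rmin 1 (eps / 3)).
  assert (Hd : 0 < d) by (unfold d; apply Rmin_glb_lt; lra).
  assert (Hd1 : d <= 1) by apply Rmin_l. assert (Hd2 : d <= eps / 3) by apply Rmin_r.
  assert (Hdd : 0 < d ^ 2) by (now apply pow_lt).
  exists (mkposreal _ Hdd). intros y Hb Hy.
  assert (Hy2 : y < d ^ 2).
  { assert (H : Rabs (y - 0) < d ^ 2) by exact Hb. apply Rabs_def2 in H. lra. }
  assert (Es : y = sqrt y ^ 2) by (symmetry; apply pow2_sqrt; lra).
  assert (Hs : 0 < sqrt y) by (now apply sqrt_lt_R0).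
  assert (Hsd : sqrt y < d).
  { rewrite <- (sqrt_pow2 d) by lra. apply sqrt_lt_1; lra. }
  rewrite Rminus_0_r, Es. eapply Rle_lt_trans; [apply Cl_1_bound; lra|lra].
Qed.

Lemma ex_derive_monom (k : nat) (y : R) : ex_derive (monom k) y.
Proof. eexists; apply is_derive_monom. Qed.

Lemma monom_S_0 (k : nat) : monom (S k) 0 = 0.
Proof. unfold monom. simpl pow. unfold Rdiv. ring. Qed.

Lemma zeta2_pos : 0 < zeta2.
Proof.
  assert (H := partial_sum_le_Series (fun m => / INR (S m) ^ 2) 0).
  rewrite sum_O in H. simpl in H.
  apply Rlt_le_trans with (/ (1 * (1 * 1))); [lra|].
  apply H; [|apply ex_series_inv_sq]. intros k. apply (inv_pow_le k 2); auto.
Qed.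

Lemma cl_poly_lim (m e : nat) : filterlim (cl_poly m e) (at_right 0) (locally 0).
Proof.
  assert (FF : Filter (at_right 0)) by (apply within_filter, locally_filter).
  revert e; induction m as [|m IH]; intros e.
  - exact (filterlim_const 0).
  - assert (H1 : filterlim (fun y => Cl (2 * S m) y * monom e y) (at_right 0) (locally (0 * monom e 0))).
    { apply filterlim_mult_R; auto.
      - apply filterlim_ext with (sin_series (2 * S m)); [intros; symmetry; apply Cl_even|].
        apply filterlim_within, sin_series_lim_0; lia.
      - apply continuous_at_right, ex_derive_monom. }
    assert (H2 : filterlim (fun y => Cl (2 * m + 1) y * monom (S e) y) (at_right 0) (locally 0)).
    { destruct m as [|m].
      - apply filterlim_ext with (fun y => (y * Cl 1 y) * (y ^ e / INR (fact (S e)))).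
        + intros y. unfold monom, Rdiv. simpl (2 * 0 + 1)%nat. simpl pow. ring.
        + set (f := INR (fact (S e))).
          assert (C := continuous_at_right (fun y => y ^ e / f) 0 ltac:(intros t; auto_derive; auto)).
          assert (H := filterlim_mult_R _ _ _ _ _ Cl_1_lim C).
          now rewrite Rmult_0_l in H.
      - apply filterlim_bounded_mult with zeta2; auto using zeta2_pos.
        + intros x. rewrite Cl_odd. apply cos_series_bound; lia.
        + assert (H := continuous_at_right _ 0 (ex_derive_monom (S e))).
          now rewrite monom_S_0 in H. }
    assert (H3 : filterlim (fun y => cl_poly m (S (S e)) y + ((-1) ^ S m * (Cl (2 * S m) y * monom e y)
         + - (-1) ^ S m * (Cl (2 * m + 1) y * monom (S e) y))) (at_right 0)
       (locally (0 + ((-1) ^ S m * (0 * monom e 0) + - (-1) ^ S m * 0)))).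
    { apply filterlim_plus_R; auto. apply filterlim_plus_R; auto;
      (apply filterlim_mult_R; auto; exact (filterlim_const _)). }
    replace (0 + _) with 0 in H3 by ring. revert H3. apply filterlim_ext.
    intros y. change (cl_poly (S m) e y) with (cl_poly m (S (S e)) y
           + (-1) ^ S m * (Cl (2 * S m) y * monom e y - Cl (2 * m + 1) y * monom (S e) y)). ring.
Qed.

(** * The closed form *)

Definition G_closed (n : nat) (x : R) : R :=
  - / INR (2 * n - 1) ^ 2 + / INR (2 * n - 1) * ln (PI * x / sin (PI * x)) - clterm n (2 * PI * x).

Lemma sin_PI_pos (x : R) : 0 < x < 1 -> 0 < sin (PI * x).
Proof. intros Hx. generalize PI_RGT_0; intros HPI. apply sin_gt_0; nra. Qed.

Lemma is_derive_ln_sin (x : R) : 0 < x < 1 ->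
  is_derive (fun t => ln (PI * t / sin (PI * t))) x (/ x - PI * (cos (PI * x) / sin (PI * x))).
Proof.
  intros Hx. assert (Hs := sin_PI_pos x Hx). assert (HPI := PI_RGT_0).
  auto_derive.
  - repeat split; [lra|]. apply Rdiv_lt_0_compat; nra.
  - field. repeat split; lra.
Qed.

Lemma pow_clterm (p : nat) (x : R) : 0 < x ->
  x ^ (2 * p + 1) * clterm (S p) (2 * PI * x)
  = INR (fact (2 * p)) / (2 * PI) ^ (2 * p + 1) * cl_poly (S p) 0 (2 * PI * x).
Proof.
  intros Hx. assert (HPI := PI_RGT_0).
  assert (H := clterm_cl_poly p (2 * PI * x) ltac:(nra)).
  rewrite Rpow_mult_distr in H.
  assert (Hp : 0 < (2 * PI) ^ (2 * p + 1)) by (apply pow_lt; lra).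
  apply Rmult_eq_reg_l with ((2 * PI) ^ (2 * p + 1)); [|lra].
  rewrite <- Rmult_assoc, H. field. lra.
Qed.

(* Multiplied out, so that every summand tends to 0 at 0+; see [gapE]. *)
Definition gap (p : nat) (x : R) : R :=
  x ^ (2 * p + 1) * G (S p) x
  + (/ INR (2 * p + 1) ^ 2 * x ^ (2 * p + 1)
     - / INR (2 * p + 1) * (x ^ (2 * p + 1) * ln (PI * x / sin (PI * x))))
  + INR (fact (2 * p)) / (2 * PI) ^ (2 * p + 1) * cl_poly (S p) 0 (2 * PI * x).

Lemma gapE (p : nat) (x : R) : 0 < x -> gap p x = x ^ (2 * p + 1) * (G (S p) x - G_closed (S p) x).
Proof.
  intros Hx. unfold gap. rewrite <- pow_clterm by auto. unfold G_closed.
  replace (2 * S p - 1)%nat with (2 * p + 1)%nat by lia. ring.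
Qed.

Lemma is_derive_gap (p : nat) (x : R) : 0 < x < 1 -> is_derive (gap p) x 0.
Proof.
  intros Hx. assert (HPI := PI_RGT_0). assert (Hs := sin_PI_pos x Hx).
  set (c := INR (2 * p + 1)).
  assert (Hc : 0 < c) by (apply lt_0_INR; lia).
  assert (Hpow : is_derive (fun t => t ^ (2 * p + 1)) x (c * x ^ (2 * p))).
  { unfold c. auto_derive; auto. replace (pred (p + (p + 0) + 1)) with (2 * p)%nat by lia.
    replace (p + (p + 0) + 1)%nat with (2 * p + 1)%nat by lia. ring. }
  assert (H1 := is_derive_pow_G p x Hx).
  assert (H2 := is_derive_scal _ _ (/ c ^ 2) _ Hpow).
  assert (H3 := is_derive_scal _ _ (/ c) _ (is_derive_mult_R _ _ _ _ _ Hpow (is_derive_ln_sin x Hx))).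
  assert (H4 : is_derive (fun t => cl_poly (S p) 0 (2 * PI * t)) x
     (2 * PI * (- (cos (PI * x) / (2 * sin (PI * x))) * monom (2 * p + 1) (2 * PI * x)))).
  { assert (Hd := is_derive_cl_poly p 0 (2 * PI * x) ltac:(nra)).
    replace (2 * PI * x / 2) with (PI * x) in Hd by field.
    assert (Hl : is_derive (fun t => 2 * PI * t) x (2 * PI)) by (auto_derive; auto; ring).
    assert (Hcomp := is_derive_comp (cl_poly (S p) 0) (fun t => 2 * PI * t) x _ _ Hd Hl).
    replace (2 * PI * _) with
      (scal (2 * PI) (- (cos (PI * x) / (2 * sin (PI * x))) * monom (0 + 2 * p + 1) (2 * PI * x) +
        (-1) ^ S p * (Cl (2 * S p) (2 * PI * x) * monom' 0 (2 * PI * x)))); [exact Hcomp|].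
    change (@scal _ _) with Rmult. simpl monom'. simpl Nat.add.
    eq_R. ring. }
  assert (H5 := is_derive_scal _ _ (INR (fact (2 * p)) / (2 * PI) ^ (2 * p + 1)) _ H4).
  assert (H := is_derive_plus _ _ _ _ _ (is_derive_plus _ _ _ _ _ H1 (is_derive_minus _ _ _ _ _ H2 H3)) H5).
  match type of H with is_derive _ _ ?d => replace 0 with d; [exact H|] end.
  change (@plus _) with Rplus. change (@minus _) with Rminus. change (@scal _ _) with Rmult.
  eq_R.
  unfold monom.
  assert (E : INR (fact (2 * p + 1)) = c * INR (fact (2 * p))).
  { unfold c. rewrite Nat.add_1_r. now rewrite <- mult_INR. }
  rewrite E. rewrite (Rpow_mult_distr (2 * PI)), (pow_add x (2 * p)), pow_1.
  assert (Hf := INR_fact_lt_0 (2 * p)).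
  assert (Hp : 0 < (2 * PI) ^ (2 * p + 1)) by (apply pow_lt; lra).
  set (f := INR (fact (2 * p))) in *. set (q := (2 * PI) ^ (2 * p + 1)) in *.
  field. repeat split; lra.
Qed.

Lemma ex_derive_even_PSeries (a : nat -> R) (M : R) :
  (forall k, Rabs (a k) <= M) -> ex_derive (fun x => x ^ 2 * PSeries a (x ^ 2)) 0.
Proof.
  intros Ha. auto_derive. repeat split; auto.
  eexists. apply is_derive_PSeries, CV_radius_gt with M; auto.
  rewrite Rmult_0_l, Rabs_R0; lra.
Qed.

Lemma gap_lim (p : nat) : filterlim (gap p) (at_right 0) (locally 0).
Proof.
  assert (FF : Filter (at_right 0)) by (apply within_filter, locally_filter).
  assert (HPI := PI_RGT_0).
  set (c := INR (2 * p + 1)). set (K := INR (fact (2 * p)) / (2 * PI) ^ (2 * p + 1)).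
  set (W := fun t => t ^ (2 * p + 1) * ((G (S p) t + / c ^ 2) + - / c * (t ^ 2 * PSeries ccoef (t ^ 2)))).
  assert (HG := ex_derive_even_PSeries _ _ (bcoef_bound (S p))).
  assert (HC := ex_derive_even_PSeries _ _ ccoef_bound).
  assert (HW : filterlim W (at_right 0) (locally 0)).
  { replace 0 with (W 0) at 2.
    2:{ unfold W. rewrite pow_add. simpl (0 ^ 1). ring. }
    apply filterlim_within. apply (ex_derive_continuous (V := R_NormedModule)).
    unfold W, G. apply (ex_derive_mult (fun t => t ^ (2 * p + 1))).
    - auto_derive; auto.
    - apply (ex_derive_plus (V := R_NormedModule)).
      + apply (ex_derive_plus (V := R_NormedModule)); [exact HG|]. apply ex_derive_const.
      + now apply ex_derive_scal. }
  assert (Hlin : filterlim (fun t => 2 * PI * t) (at_right 0) (at_right 0)).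
  { intros P [d Hd]. assert (Hd2 : 0 < d / (2 * PI)).
    { apply Rdiv_lt_0_compat; [apply cond_pos|lra]. }
    exists (mkposreal _ Hd2). intros y Hb Hy. apply Hd; [|nra].
    assert (Hb' : Rabs (y - 0) < d / (2 * PI)) by exact Hb.
    change (Rabs (2 * PI * y - 0) < d). rewrite Rminus_0_r in *.
    rewrite Rabs_pos_eq in * by nra.
    apply Rmult_lt_compat_l with (r := 2 * PI) in Hb'; [|lra].
    replace (2 * PI * (d / (2 * PI))) with (pos d) in Hb' by (field; lra). exact Hb'. }
  assert (HL := filterlim_comp _ _ _ _ _ _ _ _ Hlin (cl_poly_lim (S p) 0)).
  assert (H := filterlim_plus_R _ _ _ _ _ HW
      (filterlim_mult_R _ (fun _ => K) _ _ _ (filterlim_const K) HL)).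
  replace (0 + K * 0) with 0 in H by ring.
  revert H. apply filterlim_ext_loc.
  exists (mkposreal 1 Rlt_0_1). intros y Hb Hy.
  assert (Hb' : Rabs (y - 0) < 1) by exact Hb. apply Rabs_def2 in Hb'.
  unfold gap, W. rewrite ln_sin_PSeries by lra. fold c K. ring.
Qed.

Lemma G_closed_correct (p : nat) (x : R) : 0 < x < 1 -> G (S p) x = G_closed (S p) x.
Proof.
  intros Hx.
  assert (Hg : gap p x = 0).
  { destruct (Req_dec (gap p x) 0) as [|Hn]; auto. exfalso.
    assert (Hpos : 0 < Rabs (gap p x)) by (now apply Rabs_pos_lt).
    destruct (proj1 (filterlim_R (FF := within_filter _ _ _ _) _ _ _) (gap_lim p) _ Hpos) as [d Hd].
    set (a := Rmin (d / 2) (x / 2)).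
    assert (Hd0 := cond_pos d).
    assert (Ha : 0 < a) by (unfold a; apply Rmin_glb_lt; lra).
    assert (Ha1 : a <= d / 2) by apply Rmin_l. assert (Ha2 : a <= x / 2) by apply Rmin_r.
    assert (Hlt : Rabs (gap p a - 0) < Rabs (gap p x)).
    { apply Hd; auto. change (Rabs (a - 0) < d). rewrite Rminus_0_r, Rabs_pos_eq; lra. }
    rewrite (is_derive_0_const (gap p) a x) in Hlt; [rewrite Rminus_0_r in Hlt; lra|lra|].
    intros t Ht. apply is_derive_gap; lra. }
  rewrite gapE in Hg by lra.
  apply Rmult_integral in Hg. destruct Hg as [Hg|Hg]; [|lra].
  exfalso; revert Hg. apply pow_nonzero; lra.
Qed.

Lemma Cl_opp_even (j : nat) (x : R) : Cl (2 * S j) (- x) = - Cl (2 * S j) x.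
Proof.
  rewrite !Cl_even. unfold sin_series. rewrite <- Series_opp. apply Series_ext. intros k.
  replace (INR (S k) * - x) with (- (INR (S k) * x)) by ring. rewrite sin_neg. unfold Rdiv; ring.
Qed.

Lemma Cl_opp_odd (j : nat) (x : R) : Cl (2 * j + 1) (- x) = Cl (2 * j + 1) x.
Proof.
  destruct j as [|j].
  - unfold Cl; simpl. replace (- x / 2) with (- (x / 2)) by field. rewrite sin_neg.
    replace (2 * - sin (x / 2)) with (- (2 * sin (x / 2))) by ring. now rewrite Rabs_Ropp.
  - rewrite !Cl_odd. apply Series_ext. intros k.
    replace (INR (S k) * - x) with (- (INR (S k) * x)) by ring. now rewrite cos_neg.
Qed.

Lemma clterm_opp (n : nat) (x : R) : clterm n (- x) = clterm n x.
Proof.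
  unfold clterm, sum1. f_equal. apply sum_n_m_ext_loc. intros j Hj.
  destruct j as [|j]; [lia|]. replace (2 * S j - 1)%nat with (2 * j + 1)%nat by lia.
  rewrite Cl_opp_even, Cl_opp_odd.
  replace ((- x) ^ (2 * j + 1)) with (- (x ^ (2 * j + 1))).
  2:{ rewrite !pow_add, !pow_mult. replace ((- x) ^ 2) with (x ^ 2) by ring. ring. }
  set (b := x ^ (2 * j + 1)). set (f := INR (fact _)).
  replace (f * - b) with (- (f * b)) by ring. unfold Rdiv. rewrite Rinv_opp.
  eq_R. ring.
Qed.

Lemma ratio_opp (x : R) : PI * - x / sin (PI * - x) = PI * x / sin (PI * x).
Proof.
  replace (PI * - x) with (- (PI * x)) by ring. rewrite sin_neg.
  unfold Rdiv. rewrite Rinv_opp. ring.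
Qed.

Lemma G_closed_opp (n : nat) (x : R) : G_closed n (- x) = G_closed n x.
Proof.
  unfold G_closed. rewrite ratio_opp.
  replace (2 * PI * - x) with (- (2 * PI * x)) by ring. now rewrite clterm_opp.
Qed.

Lemma is_series_G (n : nat) (x : R) : (1 <= n)%nat -> 0 < Rabs x < 1 ->
  is_series (fun k => bcoef n k * x ^ (2 * S k)) (G_closed n x).
Proof.
  intros Hn Hx. destruct n as [|p]; [lia|].
  assert (H := is_series_even (bcoef (S p)) zeta2 x (bcoef_bound (S p)) (proj2 Hx)).
  replace (G_closed (S p) x) with (G (S p) x); [exact H|].
  destruct (Rle_dec 0 x) as [Hp|Hp].
  - rewrite Rabs_pos_eq in Hx by auto. now apply G_closed_correct.
  - rewrite Rabs_left in Hx by lra. rewrite <- G_closed_opp, <- (G_closed_correct p (- x) Hx).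
    unfold G. now replace ((- x) ^ 2) with (x ^ 2) by ring.
Qed.

Lemma ratio_pos (x : R) : 0 < Rabs x < 1 -> 0 < PI * x / sin (PI * x).
Proof.
  assert (H : forall x, 0 < x < 1 -> 0 < PI * x / sin (PI * x)).
  { intros t Ht. apply Rdiv_lt_0_compat; [generalize PI_RGT_0; nra|now apply sin_PI_pos]. }
  intros Hx. destruct (Rle_dec 0 x) as [Hp|Hp].
  - rewrite Rabs_pos_eq in Hx by auto. auto.
  - rewrite Rabs_left in Hx by lra. rewrite <- ratio_opp. auto.
Qed.

Lemma sin_PI_neq_0 (x : R) : 0 < Rabs x < 1 -> sin (PI * x) <> 0.
Proof.
  intros Hx E. generalize (ratio_pos x Hx). rewrite E. unfold Rdiv. rewrite Rinv_0. lra.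
Qed.

(** * Fibonacci and Lucas numbers *)

Lemma sqrt5_sq : sqrt 5 * sqrt 5 = 5.
Proof. apply sqrt_sqrt; lra. Qed.

Lemma sqrt5_bounds : 2 < sqrt 5 < 3.
Proof. assert (H := sqrt5_sq). assert (H0 := sqrt_pos 5). split; nra. Qed.

Lemma alpha_sq : alpha * alpha = alpha + 1.
Proof. unfold alpha. generalize sqrt5_sq; lra. Qed.

Lemma beta_sq : beta * beta = beta + 1.
Proof. unfold beta. generalize sqrt5_sq; lra. Qed.

Lemma alpha_beta : alpha * beta = -1.
Proof. unfold alpha, beta. generalize sqrt5_sq; lra. Qed.

Lemma alpha_bounds : 3 / 2 < alpha < 2.
Proof. unfold alpha. generalize sqrt5_bounds; lra. Qed.

Lemma beta_bounds : -1 < beta < - / 2.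
Proof. unfold beta. generalize sqrt5_bounds; lra. Qed.

Lemma binet_fib (n : nat) : sqrt 5 * INR (fib n) = alpha ^ n - beta ^ n.
Proof.
  assert (H : sqrt 5 * INR (fib n) = alpha ^ n - beta ^ n /\
              sqrt 5 * INR (fib (S n)) = alpha ^ S n - beta ^ S n).
  { induction n as [|n [IH1 IH2]].
    - split; [simpl; ring|]. simpl. unfold alpha, beta. field.
    - split; auto. change (fib (S (S n))) with (fib (S n) + fib n)%nat.
      rewrite plus_INR, Rmult_plus_distr_l, IH1, IH2.
      transitivity (alpha ^ n * (alpha + 1) - beta ^ n * (beta + 1)); [simpl; ring|].
      rewrite <- alpha_sq, <- beta_sq. simpl; ring. }
  apply H.
Qed.

Lemma binet_lucas (n : nat) : INR (lucas n) = alpha ^ n + beta ^ n.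
Proof.
  assert (H : INR (lucas n) = alpha ^ n + beta ^ n /\
              INR (lucas (S n)) = alpha ^ S n + beta ^ S n).
  { induction n as [|n [IH1 IH2]].
    - split; [simpl; ring|]. simpl. unfold alpha, beta. field.
    - split; auto. change (lucas (S (S n))) with (lucas (S n) + lucas n)%nat.
      rewrite plus_INR, IH1, IH2.
      transitivity (alpha ^ n * (alpha + 1) + beta ^ n * (beta + 1)); [simpl; ring|].
      rewrite <- alpha_sq, <- beta_sq. simpl; ring. }
  apply H.
Qed.

Lemma termF_eq (n : nat) (z : R) (k : nat) :
  termF n z k = bcoef n k * (alpha * z) ^ (2 * S k) - bcoef n k * (beta * z) ^ (2 * S k).
Proof.
  unfold termF, bcoef, zeta_even. rewrite binet_fib, !Rpow_mult_distr. unfold Rdiv. ring.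
Qed.

Lemma termL_eq (n : nat) (z : R) (k : nat) :
  termL n z k = bcoef n k * (alpha * z) ^ (2 * S k) + bcoef n k * (beta * z) ^ (2 * S k).
Proof.
  unfold termL, bcoef, zeta_even. rewrite binet_lucas, !Rpow_mult_distr. unfold Rdiv. ring.
Qed.

Lemma dom_scaled (z : R) : dom z -> 0 < Rabs (alpha * z) < 1 /\ 0 < Rabs (beta * z) < 1.
Proof.
  intros [H1 H2]. assert (Ha := alpha_bounds). assert (Hb := beta_bounds).
  rewrite !Rabs_mult, (Rabs_pos_eq alpha), (Rabs_left beta) by lra.
  apply Rmult_lt_compat_l with (r := alpha) in H2; [|lra].
  rewrite Rinv_r in H2 by lra. repeat split; nra.
Qed.

Lemma rhsF_eq (n : nat) (z : R) : dom z ->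
  rhsF n z = G_closed n (alpha * z) - G_closed n (beta * z).
Proof.
  intros Hz. destruct (dom_scaled z Hz) as [Ha Hb].
  assert (E : - alpha ^ 2 * sin (PI * beta * z) / sin (PI * alpha * z)
     = PI * (alpha * z) / sin (PI * (alpha * z)) / (PI * (beta * z) / sin (PI * (beta * z)))).
  { assert (Sa := sin_PI_neq_0 _ Ha). assert (Sb := sin_PI_neq_0 _ Hb).
    rewrite (Rmult_assoc PI beta), (Rmult_assoc PI alpha).
    assert (HPI := PI_RGT_0). assert (Hb' := beta_bounds).
    assert (Hz0 : z <> 0) by (intros ->; destruct Hz as [Hz _]; rewrite Rabs_R0 in Hz; lra).
    replace (- alpha ^ 2) with (alpha / beta).
    - field. repeat split; auto; lra.
    - apply Rmult_eq_reg_r with beta; [|lra]. unfold Rdiv.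
      rewrite Rmult_assoc, Rinv_l by lra.
      transitivity (- alpha * (alpha * beta)); [rewrite alpha_beta|]; ring. }
  unfold rhsF, G_closed. rewrite E, ln_div by (apply ratio_pos; auto).
  rewrite !(Rmult_assoc (2 * PI)). ring.
Qed.

Lemma rhsL_eq (n : nat) (z : R) : dom z ->
  rhsL n z = G_closed n (alpha * z) + G_closed n (beta * z).
Proof.
  intros Hz. destruct (dom_scaled z Hz) as [Ha Hb].
  assert (E : - (PI ^ 2 * z ^ 2) / (sin (PI * alpha * z) * sin (PI * beta * z))
     = PI * (alpha * z) / sin (PI * (alpha * z)) * (PI * (beta * z) / sin (PI * (beta * z)))).
  { assert (Sa := sin_PI_neq_0 _ Ha). assert (Sb := sin_PI_neq_0 _ Hb).
    rewrite (Rmult_assoc PI beta), (Rmult_assoc PI alpha).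
    replace (- (PI ^ 2 * z ^ 2)) with (PI ^ 2 * z ^ 2 * (alpha * beta)) by (rewrite alpha_beta; ring).
    field. auto. }
  unfold rhsL, G_closed. rewrite E, ln_mult by (apply ratio_pos; auto).
  rewrite !(Rmult_assoc (2 * PI)). unfold Rdiv. ring.
Qed.

Lemma is_series_termF (n : nat) (z : R) : (1 <= n)%nat -> dom z -> is_series (termF n z) (rhsF n z).
Proof.
  intros Hn Hz. destruct (dom_scaled z Hz) as [Ha Hb]. rewrite rhsF_eq by auto.
  apply (is_series_ext (V := R_NormedModule)) with (1 := fun k => eq_sym (termF_eq n z k)).
  apply (is_series_minus (V := R_NormedModule)); now apply is_series_G.
Qed.

Lemma is_series_termL (n : nat) (z : R) : (1 <= n)%nat -> dom z -> is_series (termL n z) (rhsL n z).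
Proof.
  intros Hn Hz. destruct (dom_scaled z Hz) as [Ha Hb]. rewrite rhsL_eq by auto.
  apply (is_series_ext (V := R_NormedModule)) with (1 := fun k => eq_sym (termL_eq n z k)).
  apply (is_series_plus (V := R_NormedModule)); now apply is_series_G.
Qed.

Lemma bcoef_pow_bound (n k : nat) (x : R) : Rabs x <= 1 ->
  Rabs (bcoef n k * x ^ (2 * S k)) <= zeta2 * / INR (S k) ^ 2.
Proof.
  intros Hx. unfold bcoef, Rdiv.
  assert (Hk := INR_S_ge_1 k).
  assert (Hq : INR (S k) <= INR (2 * S k - 1 + 2 * n)) by (apply le_INR; lia).
  rewrite !Rabs_mult, Rabs_inv, <- RPow_abs, (Rabs_pos_eq (_ * _)) by nra.
  assert (Hp : 0 <= Rabs x ^ (2 * S k) <= 1).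
  { split; [apply pow_le, Rabs_pos|]. rewrite <- (pow1 (2 * S k)). apply pow_incr.
    split; auto using Rabs_pos. }
  assert (Hi : 0 < / (INR (S k) * INR (2 * S k - 1 + 2 * n)) <= / INR (S k) ^ 2).
  { split; [apply Rinv_0_lt_compat; nra|]. apply Rinv_le_contravar; [apply pow_lt; lra|nra]. }
  assert (Hz := zeta_even_bound k).
  apply Rle_trans with (Rabs (zeta_even k) * / (INR (S k) * INR (2 * S k - 1 + 2 * n)) * 1).
  - apply Rmult_le_compat_l; [|lra]. apply Rmult_le_pos; [apply Rabs_pos|lra].
  - rewrite Rmult_1_r. apply Rmult_le_compat; auto using Rabs_pos; lra.
Qed.

Definition dominant (k : nat) : R := 2 * (zeta2 * / INR (S k) ^ 2).

Lemma ex_series_dominant : ex_series dominant.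
Proof.
  apply (ex_series_scal_l (V := R_NormedModule) 2), (ex_series_scal_l (V := R_NormedModule) zeta2).
  apply ex_series_inv_sq.
Qed.

Lemma closed_dom_scaled (z : R) : Rabs z <= / alpha -> Rabs (alpha * z) <= 1 /\ Rabs (beta * z) <= 1.
Proof.
  intros H2. assert (Ha := alpha_bounds). assert (Hb := beta_bounds). assert (Hp := Rabs_pos z).
  rewrite !Rabs_mult, (Rabs_pos_eq alpha), (Rabs_left beta) by lra.
  apply Rmult_le_compat_l with (r := alpha) in H2; [|lra].
  rewrite Rinv_r in H2 by lra. split; nra.
Qed.

Lemma termF_bound (n k : nat) (z : R) : Rabs z <= / alpha -> Rabs (termF n z k) <= dominant k.
Proof.
  intros Hz. destruct (closed_dom_scaled z Hz) as [Ha Hb]. rewrite termF_eq.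
  unfold Rminus, dominant. eapply Rle_trans; [apply Rabs_triang|]. rewrite Rabs_Ropp.
  generalize (bcoef_pow_bound n k _ Ha) (bcoef_pow_bound n k _ Hb); lra.
Qed.

Lemma termL_bound (n k : nat) (z : R) : Rabs z <= / alpha -> Rabs (termL n z k) <= dominant k.
Proof.
  intros Hz. destruct (closed_dom_scaled z Hz) as [Ha Hb]. rewrite termL_eq.
  unfold dominant. eapply Rle_trans; [apply Rabs_triang|].
  generalize (bcoef_pow_bound n k _ Ha) (bcoef_pow_bound n k _ Hb); lra.
Qed.

Lemma boundary_limit (term : R -> nat -> R) (rhs : R -> R) (z : R) :
  Rabs z <= / alpha ->
  (forall w, dom w -> is_series (term w) (rhs w)) ->
  (forall w k, Rabs w <= / alpha -> Rabs (term w k) <= dominant k) ->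
  (forall k, ex_derive (fun w => term w k) z) ->
  ex_series (term z) /\ filterlim rhs (within dom (locally z)) (locally (Series (term z))).
Proof.
  intros Hz Hs Hb Hd. split.
  - apply ex_series_dominated with dominant; auto using ex_series_dominant.
  - apply filterlim_ext_loc with (fun w => Series (fun k => term w k)).
    + unfold within. apply filter_forall. intros w Hw. now apply is_series_unique, Hs.
    + apply (tannery (within dom (locally z)) (FF := within_filter _ _ _ _)
        (fun k w => term w k) (term z) dominant); auto using ex_series_dominant.
      * intros k. apply filterlim_within.
        apply (ex_derive_continuous (V := R_NormedModule) (fun w => term w k)), Hd.
      * unfold within. apply filter_forall. intros w Hw k. apply Hb. destruct Hw; lra.
Qed.

Theorem theorem19 (n : nat) (z : R) :
  (1 <= n)%nat -> 0 < Rabs z <= / alpha ->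
  (Rabs z < / alpha ->
     is_series (termF n z) (rhsF n z) /\ is_series (termL n z) (rhsL n z)) /\
  (Rabs z = / alpha ->
     ex_series (termF n z) /\ ex_series (termL n z) /\
     filterlim (rhsF n) (within dom (locally z)) (locally (Series (termF n z))) /\
     filterlim (rhsL n) (within dom (locally z)) (locally (Series (termL n z)))).
Proof.
  intros Hn Hz. split; intros Hz1.
  - split; [apply is_series_termF|apply is_series_termL]; auto; split; lra.
  - assert (HF : forall k, ex_derive (fun w => termF n w k) z)
      by (intros k; unfold termF, Rdiv; set (a := sqrt 5 * _ * _); auto_derive; auto).
    assert (HL : forall k, ex_derive (fun w => termL n w k) z)
      by (intros k; unfold termL, Rdiv; set (a := INR _ * zeta _); auto_derive; auto).
    destruct (boundary_limit (termF n) (rhsF n) z (proj2 Hz)) as [F1 F2];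
      auto using is_series_termF, termF_bound.
    destruct (boundary_limit (termL n) (rhsL n) z (proj2 Hz)) as [L1 L2];
      auto using is_series_termL, termL_bound.
Qed.
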